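(* For every $\alpha>0$ there is a constant $C_\alpha>0$, depending only on $\alpha$, such that the following holds. Let $X=X_0+M+V$ be a continuous semimartingale satisfying the standing moment assumption of the context with functions $\phi_1,\phi_2$, and let $b_0\colon\mathbb R\to\mathbb R$ satisfy $|b_0(x)|\le C(1+|x|^\eta)$ for all $x$, with constants $\eta\ge0$, $C\ge1$. Let $\mathcal F$ be a countable class of real-valued functions satisfying, for fixed constants $U,\mathbb V,\mathcal S>0$ with $\mathbb V\le\sqrt{\mathcal S}$: $\sup_{x}|f(x)|\le U$ and $\|f\|_{L^2(\boldsymbol\lambda)}\le\mathbb V$ for all $f\in\mathcal F$, and each $f\in\mathcal F$ has compact support contained in an interval $[x_f,x^f]$, $x_f<x^f$, with $|x^f-x_f|\le\mathcal S$. Set $$\mathbb G_t^{b_0}(f):=\frac1{\sqrt t}\int_0^t\left(f(X_u)b_0(X_u)-\mathbb E[f(X_0)b_0(X_0)]\right)\mathrm du,\qquad f\in\mathcal F,\ t>0.$$ Assume that every $f\in\mathcal F$ admits a decomposition $\mathbb G_t^{b_0}(f)=t^{-1/2}\mathbb M_t^f+t^{-1/2}\mathbb R_t^f$, $t>0$, where $(\mathbb M_t^f)_{t\ge0}$ is a martingale with $\mathbb M_0^f=0$ and $(\mathbb R^f_t)_{t\ge 0}$ is a remainder process, and that there are constants $\Psi_1,\Psi_2$ such that, for any $f,g\in\mathcal F$, $p\ge1$ and $t>0$, $$\left(\mathbb E|\mathbb M_t^f|^p\right)^{1/p}\le\Psi_1\sqrt t\,p^{1/\alpha}\|f\|_{L^2(\boldsymbol\lambda)},\qquad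 \left(\mathbb E\Big[\sup_{f\in\mathcal F}|\mathbb R_t^f|^p\Big]\right)^{1/p}\le\Psi_2\,p,$$ $$\left(\mathbb E|\mathbb M_t^f-\mathbb M_t^g|^p\right)^{1/p}\le\Psi_1\sqrt t\,p^{1/\alpha}\|f-g\|_{L^2(\boldsymbol\lambda)}.$$ Let $\Lambda(t):=\max\{\lambda\,\mathrm e(\phi_1(t)+\mathsf c\,\phi_2(t)),1\}$ with $\lambda>1$ such that $\max\{\mathcal S,\mathrm e\,C_{\mathrm{mo}}\}<p\Lambda(t)$ for all $p,t\ge1$. For $p\ge1$ and $k\in\mathbb N_0$ define $$I_k:=\Big(\big(-2(k+1)p\Lambda(t),-2kp\Lambda(t)\big]\cup\big(2kp\Lambda(t),2(k+1)p\Lambda(t)\big]\Big)\oplus[-\mathcal S,\mathcal S],\qquad \mathcal F_k:=\{f\in\mathcal F\colon\operatorname{supp}(f)\subset I_k\}.$$ Then, for any $t,p\ge1$, whenever $\sum_{k=0}^\infty E(\mathcal F_k,\mathrm e\Psi_1\|\cdot\|_{L^2(\boldsymbol\lambda)},\alpha)\exp(-k/2)<\infty$, it holds $$\left(\mathbb E\Big[\sup_{f\in\mathcal F}|\mathbb G_t^{b_0}(f)|^p\Big]\right)^{1/p}\le C_\alpha\sum_{k=0}^\infty E(\mathcal F_k,\mathrm e\Psi_1\|\cdot\|_{L^2(\boldsymbol\lambda)},\alpha)\,\mathrm e^{-k/2}+6\Psi_1(2p)^{1/\alpha}\mathbb V+\frac{2\Psi_2p}{\sqrt t}+\sqrt t\,CU(1+2\eta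 C_{\mathrm{mo}})^\eta\exp\left(-\frac{\Lambda(t)}{2\mathrm e\,C_{\mathrm{mo}}}\right).$$
   Context: All processes live on a complete filtered probability space $(\Omega,\mathscr F,(\mathscr F_t)_{t\ge0},\mathbb P)$. $X=X_0+M+V$ is the canonical decomposition of a continuous semimartingale: $X_0$ is $\mathscr F_0$-measurable, $M$ is a continuous martingale with $M_0=0$, $V$ is a (continuous) finite variation process with $V_0=0$, and $\int_0^t|\mathrm dV_s|$ is the total variation of $V$ on $[0,t]$. Write $\|Y\|_p=(\mathbb E|Y|^p)^{1/p}$. Standing moment assumption: there exist deterministic functions $\phi_1,\phi_2\colon\mathbb R_+\to\mathbb R_+$ such that, for any $p\ge1$, $t>0$, $\|X_0\|_p+\|X_t\|_p+\|\int_0^t|\mathrm dV_s|\|_p\le p\,\phi_1(t)$ and $(\mathbb E[\langle M\rangle_t^{p/2}])^{1/p}\le\phi_2(t)$; moreover $\lim_{t\to\infty}\phi_1(t)=\infty$ and $\phi_2(t)\le\sqrt{\phi_1(t)}$. $C_{\mathrm{mo}}>0$ is a constant with $\|X_0\|_p\le p\,C_{\mathrm{mo}}$ for all $p\ge1$. The constant $\mathsf c:=\max\{1,\sqrt2\,\overline{\mathsf c}\}$, where $\overline{\mathsf c}\ge1$ is a fixed constant such that for any $p\ge2$ and any continuous martingale $N$ with $N_0=0$, $(\mathbb E[\sup_{0\le s\le t}|N_s|^p])^{1/p}\le\overline{\mathsf c}\sqrt p\,(\mathbb E[\langle N\rangle_t^{p/2}])^{1/p}$. $\boldsymbol\lambda$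 is Lebesgue measure on $\mathbb R$; $\oplus$ is the Minkowski sum. For a semi-metric space $(\mathcal F,d)$, $N(u,\mathcal F,d)$ is the smallest number of balls of radius $u$ in $(\mathcal F,d)$ needed to cover $\mathcal F$, and $E(\mathcal F,d,\alpha):=\int_0^\infty(\log N(u,\mathcal F,d))^{1/\alpha}\,\mathrm du$. Writing a (scaled) norm in place of $d$ means the induced semi-metric. *)

(* Defs.v *)
From HB Require Import structures.
From mathcomp Require Import all_boot all_order all_algebra.
From mathcomp Require Import all_classical all_reals all_analysis.
Set Implicit Arguments.
Unset Strict Implicit.
Unset Printing Implicit Defensive.
Import Order.TTheory GRing.Theory Num.Theory.
Import numFieldNormedType.Exports.
Local Open Scope classical_set_scope.
Local Open Scope ring_scope.

(* Time is R; every condition on a process or a filtration is imposed at     *)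
(* times t >= 0 only, values at negative times are irrelevant.               *)

Definition complete_filtration {R : realType} {d : measure_display}
    {T : measurableType d} (P : probability T R) (Fil : R -> set (set T)) :=
  [/\ measure_is_complete P,
      forall t : R, 0 <= t -> sigma_algebra [set: T] (Fil t),
      forall t : R, 0 <= t -> Fil t `<=` measurable,
      forall s t : R, 0 <= s -> s <= t -> Fil s `<=` Fil t &
      P.-negligible `<=` Fil 0].

Definition measurable_wrt {R : realType} {T : Type} (G : set (set T))
    (Y : T -> R) :=
  forall B : set R, measurable B -> G (Y @^-1` B).

Definition adapted {R : realType} {T : Type} (Fil : R -> set (set T))
    (Y : R -> T -> R) :=
  forall t : R, 0 <= t -> measurable_wrt (Fil t) (Y t).

(* Z is a version of E[Y | G] *)
Definition is_cond_exp {R : realType} {d : measure_display}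
    {T : measurableType d} (P : probability T R) (G : set (set T))
    (Y Z : T -> R) :=
  [/\ measurable_wrt G Z,
      P.-integrable [set: T] (EFin \o Z) &
      forall A, G A ->
        (\int[P]_(w in A) (Z w)%:E = \int[P]_(w in A) (Y w)%:E)%E].

Definition martingale {R : realType} {d : measure_display}
    {T : measurableType d} (P : probability T R) (Fil : R -> set (set T))
    (M : R -> T -> R) :=
  [/\ adapted Fil M,
      forall t : R, 0 <= t -> P.-integrable [set: T] (EFin \o M t) &
      forall s t : R, 0 <= s -> s <= t -> is_cond_exp P (Fil s) (M t) (M s)].

Definition continuous_paths {R : realType} {T : Type} (Y : R -> T -> R) :=
  forall w, {within `[0, +oo[, continuous (fun t => Y t w)}.

Definition stopping_time {R : realType} {T : Type} (Fil : R -> set (set T))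
    (tau : T -> \bar R) :=
  (forall w, 0 <= tau w)%E /\
  forall t : R, 0 <= t -> Fil t [set w | (tau w <= t%:E)%E].

Definition stopped {R : realType} {T : Type} (Y : R -> T -> R)
    (tau : T -> \bar R) : R -> T -> R :=
  fun t w => Y (fine (Order.min t%:E (tau w))) w.

Definition local_martingale {R : realType} {d : measure_display}
    {T : measurableType d} (P : probability T R) (Fil : R -> set (set T))
    (Y : R -> T -> R) :=
  adapted Fil Y /\
  exists tau : nat -> T -> \bar R,
    [/\ forall n, stopping_time Fil (tau n),
        {ae P, forall w, {homo tau^~ w : m n / (m <= n)%N >-> (m <= n)%E} /\
                         tau n w @[n --> \oo] --> +oo%E} &
        forall n, martingale P Fil (fun t w => stopped Y (tau n) t w - Y 0 w)].

(* Q = <M>, characterized as usual for a continuous martingale M with M_0 = 0 *)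
Definition quadratic_variation {R : realType} {d : measure_display}
    {T : measurableType d} (P : probability T R) (Fil : R -> set (set T))
    (M Q : R -> T -> R) :=
  [/\ adapted Fil Q, continuous_paths Q, forall w, Q 0 w = 0,
      forall w (s t : R), 0 <= s -> s <= t -> Q s w <= Q t w &
      local_martingale P Fil (fun t w => M t w ^+ 2 - Q t w)].

(* supremum in [0, +oo] (hence 0 over an empty index set) *)
Definition sup_abs {R : realType} {I T : Type} (A : set I) (Y : I -> T -> R)
    (w : T) : \bar R :=
  ereal_sup (0%E |` [set `|Y i w|%:E | i in A]).

Definition continuous_semimartingale {R : realType} {d : measure_display}
    {T : measurableType d} (P : probability T R) (Fil : R -> set (set T))
    (X M V : R -> T -> R) :=
  [/\ measurable_wrt (Fil 0) (X 0),
      [/\ martingale P Fil M, continuous_paths M & forall w, M 0 w = 0],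
      [/\ adapted Fil V, continuous_paths V, forall w, V 0 w = 0 &
          forall w (t : R), 0 <= t -> bounded_variation 0 t (fun s => V s w)] &
      forall (t : R) w, 0 <= t -> X t w = X 0 w + M t w + V t w].

Definition moment_assumption {R : realType} {d : measure_display}
    {T : measurableType d} (P : probability T R) (X V Q : R -> T -> R)
    (phi1 phi2 : R -> R) :=
  [/\ forall t : R, 0 <= t -> 0 <= phi1 t /\ 0 <= phi2 t,
      forall p t : R, 1 <= p -> 0 < t ->
        ('N[P]_p%:E[EFin \o X 0%R] + 'N[P]_p%:E[EFin \o X t]
         + 'N[P]_p%:E[(fun w => total_variation 0%R t (fun s => V s w))]
         <= (p * phi1 t)%:E)%E,
      forall p t : R, 1 <= p -> 0 < t ->
        (poweR 'E_P[(fun w => (Q t w `^ (p / 2))%R)] p^-1 <= (phi2 t)%:E)%E,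
      phi1 t @[t --> +oo] --> +oo &
      forall t : R, 0 <= t -> phi2 t <= Num.sqrt (phi1 t)].

(* The inequality is required on the given filtered space only. *)
Definition BDG_constant {R : realType} {d : measure_display}
    {T : measurableType d} (P : probability T R) (Fil : R -> set (set T))
    (cbar : R) :=
  1 <= cbar /\
  forall (p t : R) (N Q : R -> T -> R), 2 <= p -> 0 <= t ->
    martingale P Fil N -> continuous_paths N -> (forall w, N 0 w = 0) ->
    quadratic_variation P Fil N Q ->
    ('N[P]_p%:E[sup_abs `[0%R, t] N]
     <= (cbar * Num.sqrt p)%:E
        * poweR 'E_P[(fun w => (Q t w `^ (p / 2))%R)] p^-1)%E.

Definition L2norm {R : realType} (f : R -> R) : \bar R :=
  'N[lebesgue_measure]_2%:E[EFin \o f]%E.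

(* Balls are open and centred in F; N = +oo if no finite cover exists.       *)
Definition covering_number {R : realType} {T : Type} (u : R) (F : set T)
    (dist : T -> T -> \bar R) : \bar R :=
  ereal_inf [set n%:R%:E | n in [set n : nat |
    exists c : 'I_n -> T, (forall i, F (c i)) /\
      F `<=` \bigcup_i [set g | (dist (c i) g < u%:E)%E]]].

(* For empty F the integrand is poweR (lne 0) alpha^-1 = poweR -oo alpha^-1  *)
(* = 0, so that the entropy integral of the empty class is 0.                *)
Definition entropy_integral {R : realType} {T : Type} (F : set T)
    (dist : T -> T -> \bar R) (alpha : R) : \bar R :=
  (\int[lebesgue_measure]_(u in `]0%R, +oo[)
     poweR (lne (covering_number u F dist)) alpha^-1)%E.

Definition scaled_L2dist {R : realType} (a : R) (f g : R -> R) : \bar R :=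
  (a%:E * L2norm (f \- g)%R)%E.

Definition supp {R : realType} (f : R -> R) : set R :=
  closure [set x | f x != 0].

Definition minkowski_sum {R : realType} (A B : set R) : set R :=
  [set x + y | x in A & y in B].

(* L stands for p Lambda(t) *)
Definition shell {R : realType} (L S : R) (k : nat) : set R :=
  minkowski_sum
    (`](- (2 * k.+1%:R * L)), (- (2 * k%:R * L))]
     `|` `](2 * k%:R * L), (2 * k.+1%:R * L)])
    `[- S, S].

Definition subclass {R : realType} (F : set (R -> R)) (L S : R) (k : nat) :
    set (R -> R) :=
  [set f | F f /\ supp f `<=` shell L S k].

Definition empirical_process {R : realType} {d : measure_display}
    {T : measurableType d} (P : probability T R) (X : R -> T -> R)
    (b0 : R -> R) (f : R -> R) (t : R) (w : T) : R :=
  (Num.sqrt t)^-1 *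
  \int[lebesgue_measure]_(u in `[0, t])
    (f (X u w) * b0 (X u w) - \int[P]_w' (f (X 0 w') * b0 (X 0 w'))).

Definition Lambda {R : realType} (lambda c : R) (phi1 phi2 : R -> R) (t : R) :
    R :=
  Num.max (lambda * expR 1 * (phi1 t + c * phi2 t)) 1.

Definition entropy_sum {R : realType} (F : set (R -> R)) (L S Psi1 alpha : R) :
    \bar R :=
  (\sum_(0 <= k <oo)
     entropy_integral (subclass F L S k) (scaled_L2dist (expR 1 * Psi1)) alpha
     * (expR (- (k%:R / 2)))%:E)%E.

(* Main.v *)
(* Let L = p Lambda(t), let b be |X_0| plus the running maxima of |M| and |V| up
   to time t, and A_k = {b >= k L}. The Burkholder-Davis-Gundy inequality, the
   moment assumption and Markov's inequality for the moment of order k p give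
   P(A_k) <= exp(-k p). A function f of F_k, k >= 1, vanishes on |x| < k L, so
   off A_k the process G(f) is the deterministic term sqrt t E[f(X_0) b_0(X_0)],
   which is exponentially small in Lambda(t) because f vanishes on |x| < 2 L when
   f is not in F_0. On A_k, the Cauchy-Schwarz inequality bounds the L^p norm of
   the supremum of |M^f| over F_k by its L^(2p) norm times exp(-k/2), and that
   norm is bounded by chaining. Summing over k is Minkowski's inequality for the
   maximum over finitely many f, followed by monotone convergence. *)
Require Import Defs.
From mathcomp Require Import all_boot all_order all_algebra.
From mathcomp Require Import all_classical all_reals all_analysis.
From mathcomp Require Import measurable_realfun.
From mathcomp Require Import ring lra.
Set Implicit Arguments.
Unset Strict Implicit.
Unset Printing Implicit Defensive.
Import Order.TTheory GRing.Theory Num.Theory.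
Import numFieldNormedType.Exports.
Local Open Scope classical_set_scope.
Local Open Scope ring_scope.

(** The level L is proportional to p so that Markov's inequality at order k p yields exp(-k p);
    after Cauchy-Schwarz its 2p-th root is exp(-k/2), a weight free of p. Shell k starts at radius 2
    k L, twice the level of A_k, because widening it by S < L must leave it outside |x| < k L. The
    widened shells overlap, so [kappa] assigns each f to one of them, giving priority to F_0: a
    function assigned to a higher shell then lies outside F_0, which is what makes its initial mean
    small. Chaining is run on finite families only. It starts from a net so fine that the error is
    negligible, and every dyadic link is paid by a slice of the entropy integral. The factor 6 is 2,
    from the union bound at the coarsest scale, times 3, a bound for the sum of exp(-k/2); (2
    p)^(1/alpha) is the moment growth at the order doubled by Cauchy-Schwarz. *)

(** * Inequalities for L^p norms *)

Section lnorm.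
Local Open Scope ereal_scope.
Context d (T : measurableType d) (R : realType).
Implicit Types mu : {measure set T -> \bar R}.

(** The integral is a supremum over simple functions below the integrand, and [g] has more of them
    than [f]. This serves for suprema and total variations, whose measurability is not at hand. *)
Lemma le_integralT mu (f g : T -> \bar R) :
  (forall x, 0 <= f x) -> (forall x, f x <= g x) ->
  \int[mu]_x f x <= \int[mu]_x g x.
Proof.
move=> f0 fg; rewrite !ge0_integralTE//; last first.
  by move=> x; rewrite (le_trans (f0 x)).
apply: le_ereal_sup => _ [h /= hf <-]; exists h => //= x.
exact: le_trans (hf x) (fg x).
Qed.

Lemma poweR_le (x y : \bar R) (r : R) : (0 <= r)%R -> 0 <= x -> x <= y ->
  x `^ r <= y `^ r.
Proof.
move=> r0 x0 xy; apply: gt0_ler_poweR => //; rewrite in_itv/= leey andbT//.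
exact: le_trans xy.
Qed.

Lemma le_Lnorm mu (p : R) (f g : T -> \bar R) : (0 < p)%R ->
  (forall x, `|f x| <= `|g x|) -> 'N[mu]_p%:E[f] <= 'N[mu]_p%:E[g].
Proof.
move=> p0 fg; rewrite unlock; apply: poweR_le; first by rewrite invr_ge0 ltW.
  by apply: integral_ge0 => x _; exact: poweR_ge0.
by apply: le_integralT => x; [exact: poweR_ge0|exact: poweR_le (ltW p0) _ _].
Qed.

Lemma Lnorm_leP mu (p K : R) (f : T -> \bar R) : (0 < p)%R -> (0 <= K)%R ->
  'N[mu]_p%:E[f] <= K%:E <-> \int[mu]_x (`|f x| `^ p) <= (K `^ p)%:E.
Proof.
move=> p0 K0; have I0 : 0 <= \int[mu]_x (`|f x| `^ p).
  by apply: integral_ge0 => x _; exact: poweR_ge0.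
split=> H.
  rewrite -poweR_Lnorm ?gt_eqF// -poweR_EFin.
  by apply: poweR_le => //; [exact: ltW|exact: Lnorm_ge0].
rewrite unlock; apply: (le_trans (poweR_le _ I0 H)); rewrite ?invr_ge0 ?(ltW p0)//.
by rewrite poweR_EFin -powRrM divff ?gt_eqF// powRr1.
Qed.

Lemma measurable_abse_poweR (p : R) (f : T -> \bar R) :
  measurable_fun [set: T] f -> measurable_fun [set: T] (fun x => `|f x| `^ p).
Proof.
move=> mf; apply: (measurableT_comp (measurable_poweR p)).
exact: measurableT_comp.
Qed.

(** Raising [g] to +oo on a measurable null set containing the exceptional points makes the
    comparison hold everywhere and leaves the norm of [g] unchanged. *)
Lemma le_Lnorm_ae mu (p : R) (f g : T -> \bar R) : (0 < p)%R ->
  measurable_fun [set: T] g ->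
  {ae mu, forall x, `|f x| <= `|g x|} -> 'N[mu]_p%:E[f] <= 'N[mu]_p%:E[g].
Proof.
move=> p0 mg [N [mN N0 fgN]].
pose h x := if x \in N then +oo else g x.
have mh : measurable_fun [set: T] h.
  have -> : h = ((cst +oo) \_ N) \+ (g \_ (~` N)).
    apply/funext => x; rewrite /h /= !patchE in_setC.
    by case: (x \in N) => /=; rewrite ?adde0 ?add0e.
  apply: emeasurable_funD.
    by apply/(measurable_restrictT _ mN).1; exact: measurable_cst.
  apply/(measurable_restrictT _ _).1; first exact: measurableC.
  exact: measurable_funS mg.
apply: (@le_trans _ _ 'N[mu]_p%:E[h]).
  apply: le_Lnorm => // x; rewrite /h; case: ifPn => [_|]; first by rewrite leey.
  rewrite notin_setE => nN; apply: contrapT => fg; apply: nN; exact: fgN.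
rewrite unlock le_eqVlt; apply/orP; left; apply/eqP; congr (_ `^ _).
apply: ae_eq_integral => //; [exact: measurable_abse_poweR..|].
exists N; split => // x /= xN; apply: contrapT => nN; apply: xN => _.
by rewrite /h memNset.
Qed.

Lemma Lnorm_le_sup mu (p K : R) (g : nat -> T -> \bar R) (h : T -> \bar R) :
  (0 < p)%R -> (0 <= K)%R ->
  (forall n, measurable_fun [set: T] (g n)) -> (forall n x, 0 <= g n x) ->
  (forall x, {homo g^~ x : m n / (m <= n)%N >-> m <= n}) ->
  (forall x, `|h x| <= ereal_sup (range (g^~ x))) ->
  (forall n, 'N[mu]_p%:E[g n] <= K%:E) -> 'N[mu]_p%:E[h] <= K%:E.
Proof.
move=> p0 K0 mg g0 ndg hg gK; apply/Lnorm_leP => //.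
pose G n x := `|g n x| `^ p.
have mG n : measurable_fun [set: T] (G n) by exact: measurable_abse_poweR.
have G0 n x : [set: T] x -> 0 <= G n x by move=> _; exact: poweR_ge0.
have ndG x : [set: T] x -> {homo G^~ x : m n / (m <= n)%N >-> m <= n}.
  move=> _ m n mn; rewrite /G !gee0_abs//; apply: poweR_le; [exact: ltW|by []|].
  exact: ndg.
have cG := cvg_monotone_convergence (mu := mu) measurableT mG G0 ndG.
apply: (@le_trans _ _ (\int[mu]_x (fun x => limn (G^~ x)) x)).
  apply: le_integralT => x; first exact: poweR_ge0.
  have s0 : 0 <= ereal_sup (range (g^~ x)).
    by apply: le_trans (g0 0%N x) _; apply: ereal_sup_ubound; exists 0%N.
  have -> : limn (G^~ x) = ereal_sup (range (G^~ x)).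
    by apply/cvg_lim => //; apply: ereal_nondecreasing_cvgn => m n; exact: ndG.
  apply: (@le_trans _ _ (ereal_sup (range (g^~ x)) `^ p)).
    exact: poweR_le (ltW p0) _ _.
  set S := ereal_sup (range (G^~ x)).
  have S0 : 0 <= S.
    by apply: le_trans (G0 0%N x I) _; apply: ereal_sup_ubound; exists 0%N.
  (* The power is moved to the other side: it then suffices that each [g n x] is the root of a term
     below [S], and no continuity of the power at +oo is involved. *)
  suff : ereal_sup (range (g^~ x)) <= S `^ p^-1.
    move/(poweR_le (ltW p0) s0) => /le_trans; apply.
    by rewrite -poweRrM mulVf ?gt_eqF// poweRe1.
  apply: ge_ereal_sup => _ [n _ <-].
  rewrite -[g n x]gee0_abs// -[X in X <= _]poweRe1// -(@divff _ p) ?gt_eqF//.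
  rewrite poweRrM; apply: poweR_le; [by rewrite invr_ge0 ltW|exact: poweR_ge0|].
  by apply: ereal_sup_ubound; exists n.
move/cvg_lim : cG => <- //; apply: lime_le.
  apply: ereal_nondecreasing_is_cvgn => m n mn; apply: le_integralT => x.
    exact: G0.
  exact: ndG.
by apply: nearW => n; apply/Lnorm_leP.
Qed.

Lemma markov_Lnorm mu (q K a : R) (f : T -> R) :
  measurable_fun [set: T] f -> (0 < q)%R -> (0 < a)%R -> (0 <= K)%R ->
  'N[mu]_q%:E[EFin \o f] <= K%:E ->
  mu [set x | (a <= `|f x|)%R] <= ((K / a) `^ q)%:E.
Proof.
move=> mf q0 a0 K0 /(Lnorm_leP mu (EFin \o f) q0 K0) H.
set A := [set x | _].
have mA : measurable A.
  have := measurableT_comp (@normr_measurable R setT) mf.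
  move=> /(_ measurableT `[a, +oo[%classic (measurable_itv _)).
  rewrite setTI; suff -> : A = (Num.norm \o f) @^-1` `[a, +oo[%classic by [].
  by apply/seteqP; split => x /=; rewrite in_itv/= andbT.
have : (a `^ q)%:E * mu A <= (K `^ q)%:E.
  apply: le_trans H.
  rewrite -(setIT A) -integral_indic// -ge0_integralZl//; last 2 first.
  - exact/measurable_EFinP.
  - by rewrite lee_fin powR_ge0.
  apply: le_integralT => x.
    by rewrite mule_ge0// lee_fin ?powR_ge0.
  rewrite indicE; have [|] := boolP (x \in A).
    by rewrite inE mule1 -poweR_EFin => Ax; apply: poweR_le;
      rewrite ?lee_fin// ltW.
  by rewrite mule0 poweR_ge0.
rewrite -lee_pdivlMl ?powR_gt0// => /le_trans; apply.
rewrite -EFinM lee_fin powRM ?invr_ge0 ?(ltW a0)// mulrC.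
by rewrite -(powR_inv1 (powR_ge0 a q)) -(powR_inv1 (ltW a0)) powRAC.
Qed.

Lemma Lnorm_scale_le mu (p K a : R) (f : T -> R) :
  measurable_fun [set: T] f -> (0 < p)%R -> (0 <= a)%R -> (0 <= K)%R ->
  'N[mu]_p%:E[EFin \o f] <= K%:E ->
  'N[mu]_p%:E[EFin \o (fun x => (a * f x)%R)] <= (a * K)%:E.
Proof.
move=> mf p0 a0 K0 /(Lnorm_leP mu (EFin \o f) p0 K0) H.
apply/Lnorm_leP => //; first exact: mulr_ge0.
have -> : ((a * K) `^ p)%:E = (a `^ p)%:E * (K `^ p)%:E by rewrite powRM.
apply: le_trans (lee_wpmul2l _ H); last by rewrite lee_fin powR_ge0.
have mfp : measurable_fun [set: T] (fun x => `|(EFin \o f) x| `^ p).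
  by apply: measurable_abse_poweR; exact/measurable_EFinP.
rewrite -ge0_integralZl//; last 2 first.
- by move=> x _; exact: poweR_ge0.
- by rewrite lee_fin powR_ge0.
apply: le_integralT => x; first exact: poweR_ge0.
by rewrite /= lee_fin normrM (ger0_norm a0) powRM.
Qed.

(** The q-th power of a maximum is at most the sum of the q-th powers. The price [m^(1/q)] equals 2
    when q is the binary logarithm of m, which is how chaining chooses its orders. *)
Lemma Lnorm_bigmax mu (I : finType) (A : pred I) (m : nat) (q b : R)
    (g : I -> T -> R) :
  (forall i, measurable_fun [set: T] (g i)) -> (0 < q)%R -> (0 <= b)%R ->
  (#|A| <= m)%N -> (forall i, A i -> 'N[mu]_q%:E[EFin \o g i] <= b%:E) ->
  'N[mu]_q%:E[(fun x => (\big[Num.max/0%R]_(i | A i) `|g i x|%R)%:E)]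
    <= (m%:R `^ q^-1 * b)%:E.
Proof.
move=> mg q0 b0 Am H; apply/Lnorm_leP => //; first by rewrite mulr_ge0 ?powR_ge0.
have -> : ((m%:R `^ q^-1 * b) `^ q = m%:R * b `^ q)%R.
  by rewrite powRM ?powR_ge0// -powRrM mulVf ?gt_eqF// powRr1.
pose G i x := (`|g i x| `^ q)%:E.
have mG i : measurable_fun [set: T] (G i).
  apply/measurable_EFinP; apply: (measurableT_comp (measurable_powR q)).
  exact: measurableT_comp.
have G0 i x : 0 <= G i x by rewrite lee_fin powR_ge0.
apply: (@le_trans _ _ (\int[mu]_x (\sum_(i <- enum A) G i x))).
  apply: le_integralT => x; first exact: poweR_ge0.
  rewrite big_enum.
  have -> (y : R) : (`|y%:E| `^ q = (`|y| `^ q)%:E) by [].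
  have s0 : (0 <= \big[Num.max/0%R]_(i | A i) `|g i x|)%R.
    by elim/big_ind : _ => // y z y0 z0; rewrite le_max y0.
  rewrite ger0_norm//.
  pose Q (y : R) := (y `^ q)%:E <= \sum_(i in A) G i x.
  change (Q (\big[Num.max/0%R]_(i | A i) `|g i x|%R)).
  elim/big_ind : _ => [|y z Qy Qz|i Ai].
  - by rewrite /Q powR0 ?gt_eqF// sume_ge0.
  - by rewrite /Num.max; case: ifP.
  - by rewrite /Q (bigD1 i)//= leeDl//; exact: sume_ge0.
rewrite ge0_integral_sum// big_enum/=.
apply: (@le_trans _ _ (\sum_(i in A) (b `^ q)%:E)).
  apply: lee_sum => i Ai; have /Lnorm_leP := H i Ai; exact.
rewrite sumEFin sumr_const -[X in (X *+ _)%R]mul1r -mulrnAl.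
by rewrite lee_fin ler_wpM2r ?powR_ge0// ler_nat.
Qed.

(** Cauchy-Schwarz for [|f|^p] and the indicator of [A]. The measure is bounded by a 2p-th power so
    that exactly the factor [s] comes out of the norm. *)
Lemma Lnorm_indic_le mu (p K s : R) (f : T -> R) (A : set T) :
  measurable_fun [set: T] f -> measurable A -> (0 < p)%R -> (0 <= K)%R ->
  (0 <= s)%R ->
  'N[mu]_(2 * p)%:E[EFin \o f] <= K%:E -> mu A <= (s `^ (2 * p))%:E ->
  'N[mu]_p%:E[EFin \o (fun x => (\1_A x * f x)%R)] <= (s * K)%:E.
Proof.
move=> mf mA p0 K0 s0 H Am; apply/Lnorm_leP => //; first exact: mulr_ge0.
have mfp : measurable_fun [set: T] (fun x => `|f x| `^ p)%R.
  apply: (measurableT_comp (measurable_powR p)).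
  exact: measurableT_comp.
have m1 : measurable_fun [set: T] (\1_A : T -> R) by exact: measurable_indic.
have h : (2^-1 + 2^-1 = 1 :> R)%R by rewrite [RHS]splitr mul1r.
have := hoelder mu mfp m1 (ltr0n _ 2) (ltr0n _ 2) h.
rewrite Lnorm1 => H1; apply: le_trans (le_trans H1 _).
  apply: le_integralT => x; first exact: poweR_ge0.
  rewrite /= lee_fin normrM.
  rewrite indicE; case: (x \in A); rewrite ?normr1 ?mul1r ?mulr1 ?normr0 ?mul0r.
    by rewrite (ger0_norm (powR_ge0 _ _)).
  by rewrite powR0 ?gt_eqF// mulr0 normr0.
have -> : ((s * K) `^ p)%:E = (K `^ p)%:E * (s `^ p)%:E.
  by rewrite powRM// muleC.
apply: lee_pmul => //; [exact: Lnorm_ge0..| |].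
  apply/Lnorm_leP => //; first exact: powR_ge0.
  have p20 : (0 < 2 * p)%R by rewrite mulr_gt0.
  have /(Lnorm_leP mu (EFin \o f) p20 K0) := H.
  rewrite -powRrM (mulrC p); apply: le_trans.
  apply: le_integralT => x; first exact: poweR_ge0.
  by rewrite /= lee_fin (ger0_norm (powR_ge0 _ _)) -powRrM mulrC.
apply/Lnorm_leP => //; first exact: powR_ge0.
rewrite -powRrM mulrC (le_trans _ Am)//.
rewrite -[X in _ <= mu X]setIT -integral_indic//; apply: le_integralT => x.
  exact: poweR_ge0.
rewrite /= lee_fin indicE; case: (x \in A).
  by rewrite normr1 powR1.
by rewrite normr0 powR0.
Qed.

(** Hölder's inequality for [|f|^p] and the constant 1, with exponent [q / p] and its conjugate; the
    constant has norm 1 under a probability. *)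
Lemma Lnorm_le_exponent (P : probability T R) (p q : R) (f : T -> R) :
  measurable_fun [set: T] f -> (0 < p)%R -> (p <= q)%R ->
  'N[P]_p%:E[EFin \o f] <= 'N[P]_q%:E[EFin \o f].
Proof.
move=> mf p0; rewrite le_eqVlt => /predU1P[->//|pq].
have q0 : (0 < q)%R by exact: lt_trans pq.
have [->|] := eqVneq 'N[P]_q%:E[EFin \o f] +oo; first exact: leey.
rewrite -ltey -ge0_fin_numE ?Lnorm_ge0// => /fineK; set K := fine _ => KE.
have K0 : (0 <= K)%R by rewrite fine_ge0// Lnorm_ge0.
rewrite -KE; apply/Lnorm_leP => //.
have mfp : measurable_fun [set: T] (fun x => `|f x| `^ p)%R.
  apply: (measurableT_comp (measurable_powR p)).
  exact: measurableT_comp.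
pose s := (q / p)%R; pose t := (q / (q - p))%R.
have s0 : (0 < s)%R by rewrite divr_gt0.
have t0 : (0 < t)%R by rewrite divr_gt0// subr_gt0.
have st : (s^-1 + t^-1 = 1)%R.
  by rewrite /s /t !invf_div -mulrDl addrC subrK divff// gt_eqF.
have := hoelder P mfp (@measurable_cst _ _ T R setT 1%R) s0 t0 st.
rewrite Lnorm1 => H1; apply: le_trans (le_trans H1 _).
  apply: le_integralT => x; first exact: poweR_ge0.
  by rewrite /= lee_fin mulr1 (ger0_norm (powR_ge0 _ _)).
have -> : 'N[P]_t%:E[EFin \o cst 1%R] = 1.
  by rewrite [LHS](Lnorm_cst1 P t) [X in X `^ _]probability_setT poweR1r.
rewrite mule1; apply/Lnorm_leP => //; first exact: powR_ge0.
have /Lnorm_leP : 'N[P]_q%:E[EFin \o f] <= K%:E by rewrite KE.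
move=> /(_ q0 K0); rewrite -powRrM /s mulrCA divff ?gt_eqF// mulr1.
apply: le_trans; apply: le_integralT => x; first exact: poweR_ge0.
rewrite /= lee_fin (ger0_norm (powR_ge0 _ _)) -powRrM.
by rewrite mulrCA divff ?gt_eqF// mulr1.
Qed.

End lnorm.

(** * Covering numbers and the entropy integral *)

Section covering.
Context (R : realType) (I : Type) (H : set I) (dist : I -> I -> \bar R).
Local Open Scope ereal_scope.

Definition net (u : R) n (c : 'I_n -> I) :=
  (forall i, H (c i)) /\ H `<=` \bigcup_i [set g | dist (c i) g < u%:E].

Lemma covering_number_ge0 u : 0 <= covering_number u H dist.
Proof. by apply: le_ereal_inf_tmp => _ [n _ <-]; rewrite lee_fin. Qed.

Lemma covering_number_attained u : covering_number u H dist < +oo ->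
  exists n (c : 'I_n -> I), net u c /\ covering_number u H dist = n%:R%:E.
Proof.
move=> fin.
pose Q n := exists c : 'I_n -> I, net u c.
have exQ : exists n, `[< Q n >].
  apply: contrapT => nex; move: fin; suff -> : covering_number u H dist = +oo by [].
  rewrite /covering_number; set B := (X in ereal_inf X).
  suff -> : B = set0 by rewrite ereal_inf0.
  apply/seteqP; split => // y /= [n [c [c1 c2]] _]; apply: nex; exists n.
  by apply/asboolP; exists c; split.
case: (ex_minnP exQ) => n /asboolP[c nc] minn.
exists n, c; split => //; apply/eqP; rewrite eq_le; apply/andP; split.
  by apply: ereal_inf_lbound; exists n => //; case: nc => c1 c2; exists c; split.
apply: le_ereal_inf_tmp => _ [m [c' [c1 c2]] <-].
rewrite lee_fin ler_nat; apply: minn; apply/asboolP; exists c'; split => //.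
Qed.

Lemma le_covering_number u u' : (u <= u')%R ->
  covering_number u' H dist <= covering_number u H dist.
Proof.
move=> uu'; apply: ereal_inf_le_tmp => _ [n [c [c1 c2]] <-]; exists n => //.
exists c; split => // g /c2[i _ /= gi]; exists i => //=.
by apply: lt_le_trans gi _; rewrite lee_fin.
Qed.

(** The value 0 belongs to the empty class. It must be split off because its logarithm is -oo,
    outside the range where the power is monotone. *)
Lemma covering_number_neq0 u :
  covering_number u H dist = 0 \/ 1 <= covering_number u H dist.
Proof.
have [fin|] := ltP (covering_number u H dist) +oo; last first.
  by rewrite leye_eq => /eqP ->; right; rewrite leey.
have [[|n] [c [_ ->]]] := covering_number_attained fin; first by left.
by right; rewrite lee_fin ler1n.
Qed.

Definition entropy (alpha u : R) : \bar R :=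
  poweR (lne (covering_number u H dist)) alpha^-1.

Variable alpha : R.
Hypothesis alpha0 : (0 < alpha)%R.

Lemma entropy_ge0 u : 0 <= entropy alpha u.
Proof. exact: poweR_ge0. Qed.

Lemma le_entropy u u' : (u <= u')%R -> entropy alpha u' <= entropy alpha u.
Proof.
move=> uu'; have := le_covering_number uu'; rewrite /entropy.
have [->|N1 le_N] := covering_number_neq0 u'.
  by move=> _; rewrite le0_lneNy// poweRNyr ?poweR_ge0// invr_eq0 gt_eqF.
apply: poweR_le; first by rewrite invr_ge0 ltW.
  by rewrite lne_ge0.
by rewrite lee_lne// in_itv/= leey andbT covering_number_ge0//.
Qed.

(** The entropy is monotone in the scale, so preimages of rays are intervals. *)
Lemma measurable_entropy (D : set R) : measurable_fun D (entropy alpha).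
Proof.
apply: measurable_funTS; apply: (measurability _ (ErealGenOInfty.measurableE R)).
move=> _ [_ [r ->] <-]; apply: is_interval_measurable.
rewrite setTI => x z /= gx gz y /andP[xy yz].
move: gz; rewrite /= !in_itv/= !andbT => /lt_le_trans; apply.
exact: le_entropy.
Qed.

Definition entropy_tail (u : R) : \bar R :=
  \int[lebesgue_measure]_(x in `]u, +oo[) entropy alpha x.

Lemma entropy_tail_ge0 u : 0 <= entropy_tail u.
Proof. by apply: integral_ge0 => x _; exact: entropy_ge0. Qed.

(** On []u/2, u]] the nonincreasing integrand is at least its value at [u]. The rectangle so
    obtained pays for one link of the chain, and successive rectangles sit over disjoint
    intervals. *)
Lemma entropy_tail_half (u : R) : (0 < u)%R ->
  (u / 2)%:E * entropy alpha u + entropy_tail u <= entropy_tail (u / 2).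
Proof.
move=> u0; rewrite /entropy_tail.
have u2 : (u / 2 < u)%R by rewrite ltr_pdivrMr// mulr_natr mulr2n ltrDl.
have -> : `](u / 2)%R, +oo[%classic = ( `](u / 2)%R, u]%classic `|` `]u, +oo[%classic)%classic.
  apply/seteqP; split => x /=; rewrite !in_itv/= !andbT.
    by move=> ->; case: (leP x u) => _; [left|right].
  by move=> [/andP[]//|/(lt_trans u2)].
rewrite ge0_integral_setU//; last 3 first.
- exact: measurable_entropy.
- by move=> x _; exact: entropy_ge0.
- rewrite disj_set2E; apply/eqP/seteqP; split => x //= [].
  by rewrite !in_itv/= andbT => /andP[_ /le_lt_trans /[apply]]; rewrite ltxx.
apply: leeD => //.
apply: (@le_trans _ _ (\int[lebesgue_measure]_(x in `](u / 2)%R, u]) cst (entropy alpha u) x)).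
  rewrite integral_cst//; rewrite [X in _ <= _ * X]lebesgue_measure_itv /= lte_fin u2 muleC -EFinB.
  by rewrite [X in (X - _)%R]splitr addrK.
apply: ge0_le_integral => //.
- by move=> x _; exact: entropy_ge0.
- exact: measurable_entropy.
- by move=> x /=; rewrite in_itv/= => /andP[_ xu]; exact: le_entropy.
Qed.

Lemma le_entropy_tail u u' : (u <= u')%R -> entropy_tail u' <= entropy_tail u.
Proof.
move=> uu'; apply: ge0_subset_integral => //.
- exact: measurable_entropy.
- by move=> x _; exact: entropy_ge0.
- by move=> x /=; rewrite !in_itv/= !andbT; exact: le_lt_trans.
Qed.

End covering.

(** * Generic chaining for maxima over finite families *)

Section chaining.
Local Open Scope ereal_scope.
Context d (T : measurableType d) (R : realType) (P : probability T R).

Definition maxabs (I : finType) (A : pred I) (Z : I -> T -> R) (x : T) : R :=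
  (\big[Num.max/0]_(i | A i) `|Z i x|)%R.

Lemma maxabs_ge0 (I : finType) (A : pred I) (Z : I -> T -> R) x :
  (0 <= maxabs A Z x)%R.
Proof. by rewrite /maxabs; elim/big_ind : _ => // y z y0 z0; rewrite le_max y0. Qed.

Lemma le_maxabs (I : finType) (A : pred I) (Z : I -> T -> R) i x :
  A i -> (`|Z i x| <= maxabs A Z x)%R.
Proof. by move=> Ai; rewrite /maxabs (bigD1 i)//= le_max lexx. Qed.

Lemma maxabs_le (I : finType) (A : pred I) (Z : I -> T -> R) x b :
  (0 <= b)%R -> (forall i, A i -> `|Z i x| <= b)%R -> (maxabs A Z x <= b)%R.
Proof. by move=> b0 H; apply: bigmax_le. Qed.

Lemma measurable_maxabs (I : finType) (A : pred I) (Z : I -> T -> R) :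
  (forall i, A i -> measurable_fun [set: T] (Z i)) ->
  measurable_fun [set: T] (maxabs A Z).
Proof.
move=> mZ; rewrite /maxabs.
rewrite (_ : (fun x => _) = \big[(fun f g : T -> R => f \max g)%R/cst 0%R]_(i | A i)
    (fun x => `|Z i x|%R)); last first.
  by apply/funext => x; elim/big_ind2 : _ => // f1 f2 g1 g2 -> ->.
elim/big_ind : _ => [|f g mf mg|i Ai]; first exact: measurable_cst.
- exact: measurable_maxr.
- by apply: measurableT_comp => //; exact: mZ.
Qed.

Context (J : Type) (H : set J) (dist : J -> J -> \bar R) (Z : J -> T -> R).
Variables (alpha v q : R).
Hypotheses (alpha0 : (0 < alpha)%R) (v0 : (0 <= v)%R) (q1 : (1 <= q)%R).
Hypothesis mZ : forall i, H i -> measurable_fun [set: T] (Z i).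
Hypothesis normZ : forall i r, H i -> (1 <= r)%R ->
  'N[P]_r%:E[EFin \o Z i] <= (r `^ alpha^-1 * v)%:E.
Hypothesis distZ : forall i j (r u : R), H i -> H j -> (1 <= r)%R -> (0 <= u)%R ->
  dist i j < u%:E ->
  'N[P]_r%:E[EFin \o (Z i \- Z j)%R] <= (r `^ alpha^-1 * u)%:E.

(** Each point is replaced by a net point at distance less than [u]. The maximal increment may be
    measured at any order [r >= q], and this freedom keeps the union bound cheap. *)
Lemma Lnorm_maxabs_net (I : finType) (A : pred I) (c : I -> J) n
    (c' : 'I_n -> J) (r u : R) : (q <= r)%R -> (0 <= u)%R ->
  (forall i, A i -> H (c i)) -> net H dist u c' ->
  'N[P]_q%:E[EFin \o maxabs A (Z \o c)] <=
    (#|A|%:R `^ r^-1 * (r `^ alpha^-1 * u))%:E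
    + 'N[P]_q%:E[EFin \o maxabs xpredT (Z \o c')].
Proof.
move=> qr u0 Hc [Hc' cov].
have q0 : (0 < q)%R by exact: lt_le_trans q1.
have r0 : (0 < r)%R by exact: lt_le_trans qr.
have r1 : (1 <= r)%R by exact: le_trans qr.
have /choice[pi piP] : forall i, exists j,
    A i -> dist j (c i) < u%:E /\ exists k, j = c' k.
  move=> i; have [Ai|nAi] := boolP (A i); last by exists (c i).
  by have [k _ /= ck] := cov _ (Hc i Ai); exists (c' k) => _; split => //; exists k.
have Hpi i : A i -> H (pi i) by move=> /piP[_ [k ->]].
pose D i := (Z (pi i) \- Z (c i))%R.
have mD i : A i -> measurable_fun [set: T] (D i).
  by move=> Ai; apply: measurable_funB; apply: mZ; [exact: Hpi|exact: Hc].
have mmD : measurable_fun [set: T] (maxabs A D) by exact: measurable_maxabs.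
have mmc : measurable_fun [set: T] (maxabs xpredT (Z \o c')).
  by apply: measurable_maxabs => i _; apply: mZ.
apply: (@le_trans _ _ ('N[P]_q%:E[EFin \o (maxabs A D \+ maxabs xpredT (Z \o c'))%R])).
  apply: le_Lnorm => // x; rewrite /= lee_fin !ger0_norm ?addr_ge0 ?maxabs_ge0//.
  apply: maxabs_le => [|i Ai]; first by rewrite addr_ge0 ?maxabs_ge0.
  have [_ [k kE]] := piP _ Ai.
  have h1 := le_maxabs D x Ai.
  have h2 := le_maxabs (A := xpredT) (Z \o c') x (erefl : xpredT k).
  have -> : (Z \o c) i x = ((Z \o c') k x - D i x)%R.
    by rewrite /D /= kE opprB addrC subrK.
  by apply: le_trans (ler_normB _ _) _; rewrite addrC lerD.
apply: le_trans (minkowski_EFin _ _ _ _) _ => //.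
apply: leeD => //; apply: le_trans (Lnorm_le_exponent _ mmD q0 qr) _.
(* Indices outside [A] carry no measurability, so their increments are replaced by 0. *)
pose D' i x := if A i then D i x else 0%R.
rewrite (_ : _ \o _ = (fun x => (\big[Num.max/0%R]_(i | A i) `|D' i x|%R)%:E)); last first.
  apply/funext => x; rewrite /= /maxabs; congr (_%:E).
  by apply: eq_bigr => i Ai; rewrite /D' Ai.
apply: Lnorm_bigmax => //.
- move=> i; rewrite /D'; case: (boolP (A i)) => Ai; first exact: mD.
  exact: measurable_cst.
- by rewrite mulr_ge0 ?powR_ge0.
- move=> i Ai; rewrite (_ : EFin \o D' i = EFin \o D i); last first.
    by apply/funext => x; rewrite /= /D' Ai.
  by apply: distZ => //; [exact: Hpi|exact: Hc|have [] := piP _ Ai].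
Qed.

(** With at most [2^q] members the union bound at order [q] costs a factor 2. *)
Lemma Lnorm_maxabs_small (I : finType) (A : pred I) (c : I -> J) :
  (forall i, A i -> H (c i)) -> (#|A|%:R <= 2 `^ q)%R ->
  'N[P]_q%:E[EFin \o maxabs A (Z \o c)] <= (2 * (q `^ alpha^-1 * v))%:E.
Proof.
move=> Hc Aq; have q0 : (0 < q)%R by exact: lt_le_trans q1.
pose D' i x := if A i then Z (c i) x else 0%R.
rewrite (_ : _ \o _ = (fun x => (\big[Num.max/0%R]_(i | A i) `|D' i x|%R)%:E)); last first.
  apply/funext => x; rewrite /= /maxabs; congr (_%:E).
  by apply: eq_bigr => i Ai; rewrite /D' Ai.
apply: (@le_trans _ _ (#|A|%:R `^ q^-1 * (q `^ alpha^-1 * v))%:E).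
  apply: Lnorm_bigmax => //.
  - move=> i; rewrite /D'; case: (boolP (A i)) => Ai; first by apply: mZ; exact: Hc.
    exact: measurable_cst.
  - by rewrite mulr_ge0 ?powR_ge0.
  - move=> i Ai; rewrite (_ : EFin \o D' i = EFin \o Z (c i)); last first.
      by apply/funext => x; rewrite /= /D' Ai.
    by apply: normZ => //; exact: Hc.
rewrite lee_fin ler_wpM2r ?mulr_ge0 ?powR_ge0//.
apply: (@le_trans _ _ ((2 `^ q) `^ q^-1)%R).
  by rewrite ge0_ler_powR// ?invr_ge0 ?(ltW q0)// nnegrE ?powR_ge0.
by rewrite -powRrM divff ?gt_eqF// powRr1.
Qed.

(** A link from scale u to scale 2 u costs 2 * r^(1/a) * 2 u with r = ln n / ln 2. This is 8 / (ln
    2)^(1/a) times the rectangle (u / 2) * (ln n)^(1/a) of [entropy_tail_half]. *)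
Definition chaining_constant (a : R) : R := (8 * (ln 2 `^ a^-1)^-1)%R.

(* Successive scales differ by a factor 2. At a scale u with N(u) <= 2^q points
   the union bound costs a factor 2 only; otherwise the links to the scale 2u are
   bounded in the moment of order r = log_2 N(u) > q, for which N(u)^(1/r) = 2. *)
Lemma Lnorm_maxabs_chain k : forall (u : R) n (c : 'I_n -> J), (0 < u)%R ->
  net H dist u c -> covering_number u H dist = n%:R%:E ->
  covering_number (2 ^+ k * u) H dist <= (2 `^ q)%:E ->
  'N[P]_q%:E[EFin \o maxabs xpredT (Z \o c)] <=
    (2 * (q `^ alpha^-1 * v))%:E
    + (chaining_constant alpha)%:E * entropy_tail H dist alpha (u / 2).
Proof.
have q0 : (0 < q)%R by exact: lt_le_trans q1.
have ln20 : (0 < ln (2 : R))%R by rewrite ln_gt0// ltr1n.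
have K0 : (0 <= chaining_constant alpha)%R.
  by rewrite mulr_ge0// invr_ge0 powR_ge0.
have small u n (c : 'I_n -> J) : net H dist u c -> (n%:R <= 2 `^ q)%R ->
    'N[P]_q%:E[EFin \o maxabs xpredT (Z \o c)] <=
    (2 * (q `^ alpha^-1 * v))%:E
    + (chaining_constant alpha)%:E * entropy_tail H dist alpha (u / 2).
  move=> [Hc _] nq; apply: (@le_trans _ _ (2 * (q `^ alpha^-1 * v))%:E).
    by apply: Lnorm_maxabs_small => //; rewrite card_ord.
  by rewrite leeDl// mule_ge0 ?lee_fin// entropy_tail_ge0.
(* Induction on the number of doublings after which the covering number is at most [2^q]. *)
elim: k => [|k IH] u n c u0 netc cE.
  by rewrite expr0 mul1r cE lee_fin => nq; exact: small netc nq.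
move=> Hk; have [nq|nq] := leP n%:R (2 `^ q)%R; first exact: small netc nq.
have u20 : (0 < 2 * u)%R by rewrite mulr_gt0.
have uu2 : (u <= 2 * u)%R by rewrite mulr_natl mulr2n lerDl ltW.
have fin2 : covering_number (2 * u) H dist < +oo.
  by apply: le_lt_trans (le_covering_number H dist uu2) _; rewrite cE ltry.
have [n' [c' [netc' c'E]]] := covering_number_attained fin2.
have n0 : (0 < n%:R :> R)%R by apply: lt_trans nq; rewrite powR_gt0.
pose r : R := (ln n%:R / ln 2)%R.
have qr : (q <= r)%R.
  by rewrite /r ler_pdivlMr// -ln_powR ler_ln// ?posrE ?powR_gt0// ltW.
have r0 : (0 < r)%R by exact: lt_le_trans qr.
have lnn0 : (0 < ln (n%:R : R))%R by move: r0; rewrite /r pmulr_lgt0// invr_gt0.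
have nr : (n%:R `^ r^-1 = 2 :> R)%R.
  rewrite /powR gt_eqF// /r invf_div -mulrA mulVf ?gt_eqF// mulr1 lnK//.
  by rewrite posrE.
apply: le_trans (Lnorm_maxabs_net (A := xpredT) qr (ltW u20) (fun i _ => netc.1 i) netc') _.
rewrite card_ord nr.
have IH' := IH _ _ _ u20 netc' c'E.
apply: le_trans (leeD (lexx _) (IH' _)) _.
  by move: Hk; rewrite exprSr mulrA.
rewrite addeCA; apply: leeD => //.
have -> : (2 * u / 2 = u)%R by rewrite mulrAC divff ?mul1r// pnatr_eq0.
apply: (@le_trans _ _ ((chaining_constant alpha)%:E *
    ((u / 2)%:E * entropy H dist alpha u + entropy_tail H dist alpha u))).
  have e0 : 0 <= (u / 2)%:E * entropy H dist alpha u.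
    by rewrite mule_ge0 ?entropy_ge0// lee_fin divr_ge0// ltW.
  rewrite (ge0_muleDr _ e0 (entropy_tail_ge0 _ _ _ _)).
  apply: leeD => //; rewrite /entropy cE.
  have -> : lne (n%:R%:E : \bar R) = (ln n%:R)%:E by rewrite /= leNgt n0.
  rewrite poweR_EFin -!EFinM lee_fin /chaining_constant /r.
  rewrite powRM ?invr_ge0 ?(ltW ln20) ?(ltW lnn0)//.
  rewrite -(powR_inv1 (ltW ln20)) -powRAC powR_inv1 ?powR_ge0//.
  rewrite le_eqVlt; apply/orP; left; apply/eqP.
  by field; rewrite gt_eqF// powR_gt0.
by apply: lee_wpmul2l; rewrite ?lee_fin// entropy_tail_half.
Qed.

Hypothesis finE : entropy_integral H dist alpha < +oo.

Let entropy_bound (u : R) : (0 < u)%R ->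
  (u / 2)%:E * entropy H dist alpha u <= entropy_integral H dist alpha.
Proof.
move=> u0; apply: le_trans (_ : entropy_tail H dist alpha (u / 2) <= _).
  by apply: le_trans (entropy_tail_half H dist alpha0 u0); rewrite leeDl// entropy_tail_ge0.
by apply: le_entropy_tail => //; rewrite divr_ge0// ltW.
Qed.

Let entropy_fin (u : R) : (0 < u)%R -> covering_number u H dist < +oo.
Proof.
move=> u0; rewrite ltey; apply/eqP => cE; have := entropy_bound u0.
have -> : entropy H dist alpha u = +oo.
  by rewrite /entropy cE [lne +oo]/= poweRyr// invr_eq0 gt_eqF.
rewrite gt0_muley ?lte_fin ?divr_gt0// leye_eq => /eqP E.
by move: finE; rewrite E ltxx.
Qed.

(** Otherwise every covering number at a scale [2^k u] exceeds 2, and the rectangles under the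
    entropy have areas growing like [2^k], against the finite integral. *)
Lemma entropy_eventually_small (u : R) : (0 < u)%R ->
  exists k, covering_number (2 ^+ k * u) H dist <= (2 `^ q)%:E.
Proof.
move=> u0; apply: contrapT => nk.
have ln20 : (0 < ln (2 : R))%R by rewrite ln_gt0// ltr1n.
have E0 : 0 <= entropy_integral H dist alpha.
  by apply: integral_ge0 => x _; exact: poweR_ge0.
have EE : entropy_integral H dist alpha \is a fin_num by rewrite ge0_fin_numE.
set e := fine (entropy_integral H dist alpha).
have big k : (2 ^+ k * (u / 2 * ln 2 `^ alpha^-1) <= e)%R.
  rewrite -lee_fin /e fineK//.
  have k0 : (0 < 2 ^+ k * u)%R by rewrite mulr_gt0// exprn_gt0.
  apply: le_trans (entropy_bound k0).
  rewrite mulrA [X in (X * _)%R]mulrA EFinM; apply: lee_wpmul2l.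
    by rewrite lee_fin divr_ge0// ltW.
  rewrite -poweR_EFin; apply: poweR_le.
  - by rewrite invr_ge0 ltW.
  - by rewrite lee_fin ltW.
  have -> : (ln 2)%:E = lne (2%:E : \bar R) by rewrite /= leNgt ltr0n.
  rewrite lee_lne ?in_itv/= ?leey ?andbT ?covering_number_ge0//.
  have /negP := fun h => nk (ex_intro _ k h).
  rewrite -ltNge => /ltW; apply: le_trans.
  by rewrite lee_fin -[X in (X <= _)%R]powRr1// ler_powR// ler1n.
have s0 : (0 < u / 2 * ln 2 `^ alpha^-1)%R by rewrite mulr_gt0 ?divr_gt0 ?powR_gt0.
have := big (Num.truncn (e / (u / 2 * ln 2 `^ alpha^-1))).+1.
rewrite -ler_pdivlMr// leNgt => /negP; apply.
set y := (_ / _)%R; apply: lt_trans (_ : (Num.truncn y).+1%:R < _)%R.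
  exact: truncnS_gt.
by rewrite -natrX ltr_nat ltn_expl.
Qed.

(** Because the family is finite, some scale [u] makes even the crude union bound for the passage to
    a net cost at most [e]; the chain starts at that net. *)
Lemma Lnorm_maxabs_entropy (I : finType) (A : pred I) (c : I -> J) :
  (forall i, A i -> H (c i)) ->
  'N[P]_q%:E[EFin \o maxabs A (Z \o c)] <=
    (2 * (q `^ alpha^-1 * v))%:E
    + (chaining_constant alpha)%:E * entropy_integral H dist alpha.
Proof.
move=> Hc; have q0 : (0 < q)%R by exact: lt_le_trans q1.
have K0 : (0 <= chaining_constant alpha)%R.
  by rewrite mulr_ge0// invr_ge0 powR_ge0.
apply/lee_addgt0Pr => e e0.
(* The cost of that passage per unit of scale; the summand 1 keeps the divisor positive. *)
pose s := (#|A|%:R `^ q^-1 * q `^ alpha^-1 + 1)%R.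
have s0 : (0 < s)%R by rewrite ltr_wpDl// mulr_ge0 ?powR_ge0.
pose u := (e / s)%R; have u0 : (0 < u)%R by rewrite divr_gt0.
have [n [c' [netc' c'E]]] := covering_number_attained (entropy_fin u0).
have [k Hk] := entropy_eventually_small u0.
apply: le_trans (Lnorm_maxabs_net (lexx q) (ltW u0) Hc netc') _.
rewrite addeC; apply: leeD.
  apply: le_trans (Lnorm_maxabs_chain u0 netc' c'E Hk) _.
  apply: leeD => //; apply: lee_wpmul2l; first by rewrite lee_fin.
  by apply: le_entropy_tail => //; rewrite divr_ge0// ltW.
rewrite lee_fin mulrA /u mulrCA ler_piMr ?(ltW e0)//.
by rewrite ler_pdivrMr// mul1r lerDl.
Qed.

End chaining.

(** * Measurable running maxima of continuous processes *)

Section running_maximum.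
Context (R : realType).
Implicit Types (f : R -> R) (s t : R).

(** An enumeration of the rationals clipped to [0, t], dense there, so that the running maximum
    becomes a countable supremum. *)
Definition time_grid t (n : nat) : R :=
  Num.min t (Num.max 0 (oapp (ratr : rat -> R) 0 (unpickle n))).

Lemma time_grid_itv t n : 0 <= t -> 0 <= time_grid t n <= t.
Proof. by move=> t0; rewrite /time_grid ge_min lexx le_min t0 le_max lexx. Qed.

Lemma bounded_path f t : 0 <= t -> {within `[0, +oo[, continuous f} ->
  exists K, forall s, 0 <= s <= t -> `|f s| <= K.
Proof.
move=> t0 cf.
have cf' : {within `[0, t], continuous f}.
  by apply: continuous_subspaceW cf => x /=; rewrite !in_itv/= => /andP[->].
have [c1 _ H1] := EVT_max t0 cf'; have [c2 _ H2] := EVT_min t0 cf'.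
exists (`|f c1| + `|f c2|) => s st.
have sI : s \in `[0, t] by rewrite in_itv.
rewrite ler_norml; apply/andP; split.
  rewrite opprD; apply: le_trans (H2 _ sI).
  rewrite -[leRHS]add0r; apply: lerD; first by rewrite oppr_le0.
  by rewrite lerNl -normrN ler_norm.
apply: le_trans (H1 _ sI) _; rewrite -[leLHS]addr0.
by apply: lerD => //; exact: ler_norm.
Qed.

Lemma path_le_grid f t K : {within `[0, +oo[, continuous f} ->
  (forall n, `|f (time_grid t n)| <= K) ->
  forall s, 0 <= s <= t -> `|f s| <= K.
Proof.
move=> cf fK s /andP[s0 st]; rewrite leNgt; apply/negP => Ks.
have t0 : 0 <= t by exact: le_trans st.
pose e := `|f s| - K; have e0 : 0 < e by rewrite subr_gt0.
have sI : `[0, +oo[%classic s by rewrite /= in_itv/= s0.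
have /subspace_continuousP/(_ _ sI)/cvgr_dist_lt/(_ _ e0) := cf.
rewrite near_withinE => /nbhs_ballP[r /= r0 Hr].
have [q] : exists q : rat, ratr q \in `](s - r), (s + r)[.
  by apply: rat_in_itvoo; rewrite ltrD2l gtrN.
rewrite in_itv/= => /andP[q1 q2].
have gE : time_grid t (pickle q) = Num.min t (Num.max 0 (ratr q)).
  by rewrite /time_grid pickleK.
have /andP[g0 gt] := time_grid_itv (pickle q) t0.
(* Clipping to [0, t] cannot move the rational away from [s], which lies in that interval. *)
have sg : `|s - time_grid t (pickle q)| < r.
  rewrite gE ltr_norml /Num.min /Num.max.
  by apply/andP; case: (ltP 0 (ratr q : R)) => ?; case: (ltP t _) => ?; split; lra.
have := Hr _ sg; rewrite /= in_itv/= g0 => /(_ isT).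
have := fK (pickle q); have := ler_dist_dist (f s) (f (time_grid t (pickle q))).
have := ler_norm (`|f s| - `|f (time_grid t (pickle q))|).
rewrite /e; lra.
Qed.

Context d (T : measurableType d).
Implicit Types Y : R -> T -> R.

Definition running_max Y t (w : T) : R :=
  sups (fun n => `|Y (time_grid t n) w|) 0.

Lemma has_ubound_path Y t w : 0 <= t -> continuous_paths Y ->
  has_ubound (range (fun n => `|Y (time_grid t n) w|)).
Proof.
move=> t0 cY; have [K HK] := bounded_path t0 (cY w).
by exists K => _ [n _ <-]; apply: HK; exact: time_grid_itv.
Qed.

Lemma le_running_max Y t s w : continuous_paths Y -> 0 <= s <= t ->
  `|Y s w| <= running_max Y t w.
Proof.
move=> cY st; have t0 : 0 <= t by case/andP: st; exact: le_trans.
apply: (path_le_grid (cY w) _ st) => n; rewrite /running_max /sups.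
apply: ub_le_sup; last by exists n.
have [K HK] := has_ubound_path w t0 cY.
by exists K => _ [m _ <-]; apply: HK; exists m.
Qed.

Lemma running_max_ge0 Y t w : continuous_paths Y -> 0 <= t ->
  0 <= running_max Y t w.
Proof.
move=> cY t0; apply: le_trans (normr_ge0 (Y 0 w)) _.
by apply: le_running_max => //; rewrite lexx.
Qed.

Lemma running_max_le Y t w (z : \bar R) : 0 <= t ->
  (forall s, 0 <= s <= t -> (`|Y s w|%:E <= z)%E) ->
  ((running_max Y t w)%:E <= z)%E.
Proof.
move=> t0; case: z => [r| |] H; [|exact: leey|]; last first.
  by have := H 0; rewrite lexx t0 leeNy_eq => /(_ isT)/eqP.
rewrite lee_fin; apply: ge_sup; first by exists `|Y (time_grid t 0) w|, 0%N.
by move=> _ [n _ <-]; rewrite -lee_fin; apply: H; exact: time_grid_itv.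
Qed.

Lemma measurable_running_max Y t : 0 <= t -> continuous_paths Y ->
  (forall s, 0 <= s -> measurable_fun [set: T] (Y s)) ->
  measurable_fun [set: T] (running_max Y t).
Proof.
move=> t0 cY mY.
apply: (measurable_fun_sups (h := fun n w => `|Y (time_grid t n) w|)) => [w _|n].
  exact: has_ubound_path.
apply: measurableT_comp => //; apply: mY.
by case/andP: (time_grid_itv n t0).
Qed.

End running_maximum.

(** * Moments and tails of the path bound *)

Section semimartingale_bound.
Context (R : realType) d (T : measurableType d) (P : probability T R).
Context (Fil : R -> set (set T)) (X M V Q : R -> T -> R) (phi1 phi2 : R -> R).
Variable cbar : R.
Hypotheses (fil : complete_filtration P Fil)
  (smX : continuous_semimartingale P Fil X M V)
  (qvM : quadratic_variation P Fil M Q)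
  (momX : moment_assumption P X V Q phi1 phi2)
  (bdg : BDG_constant P Fil cbar).

Definition path_bound t w :=
  `|X 0 w| + running_max M t w + running_max V t w.

Lemma adapted_measurable Y s : adapted Fil Y -> 0 <= s ->
  measurable_fun [set: T] (Y s).
Proof.
move=> aY s0 _ B mB; rewrite setTI; case: fil => _ _ Fm _ _.
exact: Fm s s0 _ (aY s s0 B mB).
Qed.

Lemma measurable_X0 : measurable_fun [set: T] (X 0).
Proof.
case: smX => mX _ _ _ _ B mB; rewrite setTI; case: fil => _ _ Fm _ _.
by apply: (Fm 0 (lexx _)); exact: mX.
Qed.

Lemma measurable_path_bound t : 0 <= t -> measurable_fun [set: T] (path_bound t).
Proof.
move=> t0; case: smX => _ [[aM _ _] cM _] [aV cV _ _] _.
have mX := measurable_X0.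
apply: measurable_funD; first apply: measurable_funD.
- exact: measurableT_comp.
- by apply: measurable_running_max => // s; exact: adapted_measurable.
- by apply: measurable_running_max => // s; exact: adapted_measurable.
Qed.

Lemma le_path_bound t s w : 0 <= s <= t -> `|X s w| <= path_bound t w.
Proof.
move=> /andP[s0 st]; case: smX => _ [_ cM _] [_ cV _ _] XE; rewrite XE//.
have st' : 0 <= s <= t by rewrite s0.
apply: le_trans (ler_normD _ _) _; apply: lerD; last exact: le_running_max.
apply: le_trans (ler_normD _ _) _; apply: lerD => //; exact: le_running_max.
Qed.

(* Burkholder-Davis-Gundy is only available for moments of order at least 2;
   below, the second moment costs the factor sqrt 2. *)
Lemma Lnorm_running_max_martingale (q t : R) : 1 <= q -> 0 < t ->
  ('N[P]_q%:E[EFin \o running_max M t] <=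
    (q * (Num.max 1 (Num.sqrt 2 * cbar) * phi2 t))%:E)%E.
Proof.
move=> q1 t0; have t0' := ltW t0; case: smX => _ [mM cM M0] _ _.
case: momX => phi0 _ momQ _ _; have [_ p20] := phi0 t t0'.
case: bdg => cb1 BDG.
have cb0 : 0 <= cbar by exact: le_trans cb1.
have aM : adapted Fil M by case: mM.
have mrM : measurable_fun [set: T] (running_max M t).
  by apply: measurable_running_max => // s; exact: adapted_measurable.
have key r : 2 <= r -> ('N[P]_r%:E[EFin \o running_max M t] <=
    (cbar * Num.sqrt r * phi2 t)%:E)%E.
  move=> r2; have r0 : 0 < r by apply: lt_le_trans r2.
  apply: (@le_trans _ _ ('N[P]_r%:E[sup_abs `[0%R, t]%classic M])%E).
    apply: le_Lnorm => // w; rewrite gee0_abs ?lee_fin ?running_max_ge0//.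
    apply: le_trans (lee_abs _); apply: running_max_le => // s st.
    by apply: ereal_sup_ubound; right; exists s => //=; rewrite in_itv.
  apply: le_trans (BDG r t M Q r2 t0' mM cM M0 qvM) _.
  rewrite [leRHS]EFinM; apply: lee_wpmul2l.
    by rewrite lee_fin mulr_ge0 ?sqrtr_ge0.
  by apply: momQ => //; apply: le_trans r2; rewrite ler1n.
have max1 : 1 <= Num.max 1 (Num.sqrt 2 * cbar) by rewrite le_max lexx.
have max2 : Num.sqrt 2 * cbar <= Num.max 1 (Num.sqrt 2 * cbar).
  by rewrite le_max lexx orbT.
have [q2|q2] := leP 2 q.
  apply: le_trans (key q q2) _; rewrite lee_fin mulrA ler_wpM2r//.
  (* The growth sqrt q is relaxed to q, the growth of the other two terms of the path bound. *)
  have h1 : Num.sqrt q <= q.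
    rewrite -[leRHS](sqr_sqrtr (le_trans ler01 q1)) expr2 ler_peMr ?sqrtr_ge0//.
    by rewrite -(@sqrtr1 R) ler_sqrt// (le_trans _ q1).
  rewrite mulrC; apply: ler_pM => //; rewrite ?sqrtr_ge0//.
  apply: le_trans max2; rewrite ler_peMl//.
  by rewrite -[leLHS](@sqrtr1 R) ler_sqrt// ler1n.
have q0 : 0 < q by exact: lt_le_trans q1.
apply: le_trans (Lnorm_le_exponent P mrM q0 (ltW q2)) _.
apply: le_trans (key 2 (lexx _)) _; rewrite lee_fin mulrA ler_wpM2r//.
rewrite mulrC; apply: le_trans max2 _.
by rewrite ler_peMl// (le_trans ler01 max1).
Qed.

Lemma Lnorm_path_bound (q t : R) : 1 <= q -> 0 < t ->
  ('N[P]_q%:E[EFin \o path_bound t] <=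
    (q * (phi1 t + Num.max 1 (Num.sqrt 2 * cbar) * phi2 t))%:E)%E.
Proof.
move=> q1 t0; have t0' := ltW t0.
have q0 : 0 < q by exact: lt_le_trans q1.
have mX := measurable_X0.
have := Lnorm_running_max_martingale q1 t0.
case: smX => _ [[aM _ _] cM _] [aV cV V0 bV] _ HM.
case: momX => _ /(_ q t q1 t0) momV _ _ _.
have mrM : measurable_fun [set: T] (running_max M t).
  by apply: measurable_running_max => // s; exact: adapted_measurable.
have mrV : measurable_fun [set: T] (running_max V t).
  by apply: measurable_running_max => // s; exact: adapted_measurable.
(* Since V starts at 0, each |V_s| is an increment and hence at most the total variation. *)
have HV : ('N[P]_q%:E[EFin \o running_max V t] <=
    'N[P]_q%:E[(fun w => total_variation 0%R t (fun s => V s w))])%E.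
  apply: le_Lnorm => // w; rewrite gee0_abs ?lee_fin ?running_max_ge0//.
  apply: le_trans (lee_abs _); apply: running_max_le => // s /andP[s0 st].
  have := total_variation_ge (fun s => V s w) s0; rewrite V0 subr0.
  move/le_trans; apply.
  by apply: (total_variation_nondecreasing (b := t)); rewrite ?in_itv/= ?lexx ?s0 ?t0'.
have mnX : measurable_fun [set: T] (fun w => `|X 0 w|) by exact: measurableT_comp.
have HX : ('N[P]_q%:E[EFin \o (fun w => `|X 0%R w|%R)] = 'N[P]_q%:E[EFin \o X 0%R])%E.
  rewrite -[RHS]Lnorm_abse; exact: eq_Lnorm.
have mXM : measurable_fun [set: T] ((fun w => `|X 0 w|) \+ running_max M t).
  exact: measurable_funD.
have := minkowski_EFin P mXM mrV q1; move=> /le_trans; apply.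
apply: le_trans (leeD (minkowski_EFin P mnX mrM q1) (lexx _)) _.
rewrite HX mulrDr EFinD.
apply: le_trans (leeD (leeD (lexx _) HM) HV) _.
rewrite addeAC; apply: leeD => //.
apply: le_trans momV; apply: leeD => //.
by rewrite leeDl// Lnorm_ge0.
Qed.

(** The factor e in [Lambda] makes the norm of order k p at most 1/e times the level, so Markov's
    inequality gives exp(-k p). It is written as the 2p-th power expected by [Lnorm_indic_le]. *)
Lemma prob_path_bound (lambda p t : R) (k : nat) :
  1 < lambda -> 1 <= p -> 0 < t -> (0 < k)%N ->
  (P [set w | (k%:R * (p * Lambda lambda (Num.max 1 (Num.sqrt 2 * cbar))
                             phi1 phi2 t) <= `|path_bound t w|)%R] <=
    (expR (- (k%:R / 2)) `^ (2 * p))%:E)%E.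
Proof.
move=> l1 p1 t0 k0; have t0' := ltW t0.
set Lam := Lambda _ _ _ _ _; pose L := p * Lam; rewrite -/L.
have p0 : 0 < p by exact: lt_le_trans p1.
have k1 : 1 <= k%:R :> R by rewrite ler1n.
have kp1 : 1 <= k%:R * p by rewrite mulr_ege1.
have kp0 : 0 < k%:R * p by exact: lt_le_trans kp1.
have Lam0 : 0 < Lam by rewrite /Lam /Lambda lt_max ltr01 orbT.
have kL0 : 0 < k%:R * L by rewrite mulrA mulr_gt0.
pose K := k%:R * p * (Lam / expR 1).
have K0 : 0 <= K by rewrite mulr_ge0 ?divr_ge0 ?expR_ge0 ?(ltW kp0) ?(ltW Lam0).
have HK : ('N[P]_(k%:R * p)%:E[EFin \o path_bound t] <= K%:E)%E.
  apply: le_trans (Lnorm_path_bound kp1 t0) _.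
  rewrite lee_fin ler_wpM2l ?(ltW kp0)// ler_pdivlMr ?expR_gt0//.
  rewrite /Lam /Lambda le_max; apply/orP; left.
  rewrite mulrC -mulrA ler_peMl ?(ltW l1)// mulr_ge0 ?expR_ge0//.
  case: momX => /(_ t t0')[p10 p20] _ _ _ _.
  by rewrite addr_ge0// mulr_ge0// le_max ler01.
apply: le_trans (markov_Lnorm (measurable_path_bound t0') kp0 kL0 K0 HK) _.
have -> : K / (k%:R * L) = expR (- 1).
  rewrite expRN /K /L; field.
  by rewrite !gt_eqF ?expR_gt0// ltr0n.
rewrite lee_fin le_eqVlt; apply/orP; left; apply/eqP.
rewrite /powR !gt_eqF ?expR_gt0// !expRK; congr expR; by field.
Qed.

End semimartingale_bound.

(** * The initial mean of a function vanishing near the origin *)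

Section initial_mean.
Context (R : realType) d (T : measurableType d) (P : probability T R).
Variables (X0 : T -> R) (Cmo : R).
Hypotheses (mX0 : measurable_fun [set: T] X0) (Cmo0 : 0 < Cmo)
  (momX0 : forall p, 1 <= p -> ('N[P]_p%:E[EFin \o X0] <= (p * Cmo)%:E)%E).

(** From 1 + 1/2 <= exp(1/2). The value s = 2/3 is small enough for both later uses: 1 / (1 - s) = 3
    and s^3 + s <= 1. *)
Lemma expRN_half_le : expR (- 2^-1) <= 2 / 3 :> R.
Proof.
rewrite expRN -[leRHS]invrK lef_pV2 ?posrE ?expR_gt0//.
have := expR_ge1Dx (2^-1 : R); apply: le_trans; rewrite invf_div; lra.
Qed.

Lemma expR1_le4 : expR 1 <= 4 :> R.
Proof.
have h := expR_ge1Dx (- 2^-1 : R); rewrite expRN in h.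
have h2 : expR 2^-1 <= 2 :> R.
  rewrite -[leLHS]invrK -[leRHS]invrK lef_pV2 ?posrE ?invr_gt0 ?expR_gt0//.
  by apply: le_trans h; lra.
have -> : expR 1 = expR 2^-1 * expR 2^-1 :> R by rewrite -expRD; congr expR; field.
have h0 := expR_ge0 (2^-1 : R); nra.
Qed.

Let large (b : R) : set T := [set w | b <= `|X0 w|].

Let measurable_large b : measurable (large b).
Proof.
have := measurableT_comp (@normr_measurable R setT) mX0.
move=> /(_ measurableT `[b, +oo[%classic (measurable_itv _)).
rewrite setTI; suff -> : large b = (Num.norm \o X0) @^-1` `[b, +oo[%classic by [].
by apply/seteqP; split => x /=; rewrite in_itv/= andbT.
Qed.

Let measurable_tail (eta b : R) :
  measurable_fun [set: T] (fun w => (`|X0 w| `^ eta * \1_(large b) w)%:E).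
Proof.
apply/measurable_EFinP; apply: measurable_funM.
  apply: (measurableT_comp (measurable_powR eta)).
  exact: measurableT_comp.
exact: measurable_indic.
Qed.

(** Where |X_0| >= b, the factor (|X_0| / b)^(q - eta) is at least 1 and raises the power to q. *)
Lemma tail_moment (eta q b : R) : 0 <= eta <= q -> 1 <= q -> 0 < b ->
  (\int[P]_w (`|X0 w| `^ eta * \1_(large b) w)%:E <=
    ((q * Cmo) `^ q / b `^ (q - eta))%:E)%E.
Proof.
move=> /andP[eta0 etaq] q1 b0; have q0 : 0 < q by exact: lt_le_trans q1.
have qC0 : 0 <= q * Cmo by rewrite mulr_ge0// ltW.
have bq0 : 0 < b `^ (q - eta) by rewrite powR_gt0.
have /(Lnorm_leP P (EFin \o X0) q0 qC0) := momX0 q1 => H.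
rewrite EFinM muleC lee_pdivlMl//; apply: le_trans H.
rewrite -ge0_integralZl//; last by rewrite lee_fin ltW.
apply: le_integralT => w.
  by rewrite mule_ge0 ?lee_fin ?mulr_ge0 ?powR_ge0.
rewrite /= -EFinM lee_fin indicE; have [|_] := boolP (w \in large b); last first.
  by rewrite !mulr0 powR_ge0.
rewrite inE mulr1 /large /= => bX.
have X0w : 0 < `|X0 w| by exact: lt_le_trans bX.
apply: (@le_trans _ _ (`|X0 w| `^ (q - eta) * `|X0 w| `^ eta)).
  rewrite ler_wpM2r ?powR_ge0// ge0_ler_powR ?subr_ge0// nnegrE ?(ltW b0)//.
by rewrite -powRD ?subrK// gt_eqF// implybT.
Qed.

(* With r = a / (e Cmo): if eta <= 2r, the moment of order q = 2r is used,
   together with e x <= exp x at x = r / eta; if eta > 2r, the moment of order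
   eta suffices since 2^-eta <= 4^-r <= exp (-r). *)
Lemma tail_moment_exp (eta a : R) : 0 <= eta -> expR 1 * Cmo < a ->
  (\int[P]_w (`|X0 w| `^ eta * \1_(large (2 * a)) w)%:E <=
    ((2 * eta * Cmo) `^ eta * expR (- (a / (expR 1 * Cmo))))%:E)%E.
Proof.
move=> eta0 aC; have e0 := expR_gt0 (1 : R).
have eC0 : 0 < expR 1 * Cmo by rewrite mulr_gt0.
have a0 : 0 < a by exact: lt_trans aC.
set r := a / (expR 1 * Cmo).
have r1 : 1 < r by rewrite /r ltr_pdivlMr// mul1r.
have b0 : 0 < 2 * a by rewrite mulr_gt0.
(* At order q = 2 r one has q Cmo = 2 a / e, so [tail_moment] gives (2 a)^eta exp(-2 r). One factor
   exp(-r) is kept, the other absorbs (2 a)^eta up to (2 eta Cmo)^eta. *)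
have [er|re] := leP eta (2 * r).
  have q1 : 1 <= 2 * r by lra.
  apply: le_trans (tail_moment _ q1 b0) _; first by rewrite eta0 er.
  rewrite lee_fin ler_pdivrMr ?powR_gt0//.
  have -> : 2 * r * Cmo = 2 * a * (expR (-1)).
    by rewrite expRN /r; field; rewrite !gt_eqF.
  rewrite powRM ?expR_ge0 ?(ltW b0)//.
  have -> : expR (-1) `^ (2 * r) = expR (- (2 * r)) :> R.
    by rewrite /powR gt_eqF ?expR_gt0// expRK mulrN1.
  have -> : (2 * a) `^ (2 * r) = (2 * a) `^ eta * (2 * a) `^ (2 * r - eta).
    by rewrite -powRD ?(gt_eqF b0) ?implybT// addrC subrK.
  rewrite mulrAC; apply: ler_wpM2r; first exact: powR_ge0.
  have -> : - (2 * r) = - r + - r by ring.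
  rewrite expRD mulrA; apply: ler_wpM2r; first exact: expR_ge0.
  rewrite expRN ler_pdivrMr ?expR_gt0//.
  (* The case eta = 0 is separate because r / eta is used below. *)
  move: eta0; rewrite le_eqVlt => /predU1P[<-|eta0].
    by rewrite !powRr0 mul1r -expR0 ler_expR ltW// (lt_trans _ r1).
  have -> : 2 * a = 2 * eta * Cmo * (expR 1 * (r / eta)).
    by rewrite /r; field; rewrite !gt_eqF.
  have h0 : 0 <= 2 * eta * Cmo by rewrite !mulr_ge0// ltW.
  have h1 : 0 <= expR 1 * (r / eta).
    by rewrite mulr_ge0 ?(ltW e0)// divr_ge0 ?(ltW eta0)// (le_trans _ (ltW r1)).
  rewrite powRM// ler_wpM2l ?powR_ge0//.
  apply: (@le_trans _ _ (expR (r / eta) `^ eta)).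
    rewrite ge0_ler_powR ?(ltW eta0) ?nnegrE ?expR_ge0//.
    have := expR_ge1Dx (r / eta - 1); rewrite [in leLHS]addrC subrK expRD expRN.
    by rewrite ler_pdivlMr// mulrC.
  rewrite {1}/powR gt_eqF ?expR_gt0// expRK mulrC divfK// gt_eqF//.
have eta1 : 1 <= eta by lra.
have eta00 : 0 < eta by lra.
apply: le_trans (tail_moment _ eta1 b0) _; first by rewrite eta0 lexx.
rewrite lee_fin subrr powRr0 divr1 -mulrA.
have -> : (2 * (eta * Cmo)) `^ eta = 2 `^ eta * (eta * Cmo) `^ eta.
  by rewrite powRM// mulr_ge0// ltW.
rewrite [X in _ <= X * _]mulrC -mulrA ler_peMr ?powR_ge0//.
rewrite expRN ler_pdivlMr ?expR_gt0// mul1r.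
apply: (@le_trans _ _ ((2 `^ 2) `^ r)).
  have <- : expR 1 `^ r = expR r by rewrite /powR gt_eqF ?expR_gt0// expRK mulr1.
  have -> : 2 `^ 2 = 4 :> R by rewrite powR_mulrn// -natrX.
  rewrite ge0_ler_powR ?nnegrE ?expR_ge0 ?expR1_le4//.
  exact: ltW (lt_trans ltr01 r1).
by rewrite -powRrM ler_powR ?ler1n// ltW.
Qed.

Variables (f b0 : R -> R) (U C eta a : R).
Hypotheses (mf : measurable_fun [set: R] f) (mb0 : measurable_fun [set: R] b0).
Hypotheses (fU : forall x, `|f x| <= U) (U0 : 0 <= U) (C0 : 0 <= C).
Hypotheses (eta0 : 0 <= eta) (b0C : forall x, `|b0 x| <= C * (1 + `|x| `^ eta)).
Hypotheses (aC : expR 1 * Cmo < a) (f0 : forall x, `|x| < 2 * a -> f x = 0).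

(** The growth bound on [b0] splits the mean into tail moments of orders 0 and eta. The base 1 + 2
    eta Cmo dominates both 1 and 2 eta Cmo, so a common factor [D] can be extracted. *)
Lemma initial_mean_le :
  `| \int[P]_w (f (X0 w) * b0 (X0 w)) | <=
    C * U * (1 + 2 * eta * Cmo) `^ eta * expR (- (a / (2 * expR 1 * Cmo))).
Proof.
have eC0 : 0 < expR 1 * Cmo by rewrite mulr_gt0 ?expR_gt0.
set r := a / (expR 1 * Cmo).
have r1 : 1 < r by rewrite /r ltr_pdivlMr// mul1r.
have -> : a / (2 * expR 1 * Cmo) = r / 2.
  by rewrite /r; field; rewrite !gt_eqF ?expR_gt0.
set B := _ * expR _.
have mg : measurable_fun [set: T] (EFin \o (fun w => f (X0 w) * b0 (X0 w))).
  apply/measurable_EFinP; apply: measurable_funM.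
    exact: (measurableT_comp mf).
  exact: (measurableT_comp mb0).
have D0 : 0 <= 2 * eta * Cmo by rewrite !mulr_ge0// ltW.
set D := (1 + 2 * eta * Cmo) `^ eta in B *.
have D1 : 1 <= D.
  have <- : 1 `^ eta = 1 :> R by rewrite powR1.
  by rewrite /D ge0_ler_powR ?nnegrE ?addr_ge0// lerDl.
have D2 : (2 * eta * Cmo) `^ eta <= D.
  by rewrite /D ge0_ler_powR ?nnegrE ?addr_ge0// lerDr.
have key : (\int[P]_w `|f (X0 w) * b0 (X0 w)|%:E <= B%:E)%E.
  pose g (e : R) w := (`|X0 w| `^ e * \1_(large (2 * a)) w)%:E.
  apply: (@le_trans _ _ (\int[P]_w ((C * U)%:E * (g 0%R w + g eta w)))%E).
    apply: le_integralT => w; first by rewrite lee_fin.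
    rewrite /g -EFinD -EFinM lee_fin -mulrDl powRr0.
    rewrite indicE; have [|] := boolP (w \in large (2 * a)).
      rewrite mulr1 normrM (mulrC C) -mulrA => _.
      by apply: ler_pM.
    rewrite notin_setE /large /= => /negP; rewrite -ltNge => /f0 ->.
    by rewrite mul0r normr0 !mulr0.
  have g0 e w : [set: T] w -> (0 <= g e w)%E.
    by move=> _; rewrite lee_fin mulr_ge0 ?powR_ge0.
  rewrite ge0_integralZl//; last 3 first.
  - by apply: emeasurable_funD; exact: measurable_tail.
  - by move=> w _; rewrite adde_ge0 ?g0.
  - by rewrite lee_fin mulr_ge0.
  rewrite ge0_integralD//; [|exact: g0|exact: measurable_tail|exact: g0|exact: measurable_tail].
  apply: (@le_trans _ _ ((C * U)%:E * (expR (- (2 * r)) + D * expR (- r))%:E)%E).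
    apply: lee_wpmul2l; first by rewrite lee_fin mulr_ge0.
    rewrite EFinD; apply: leeD; last first.
      apply: le_trans (tail_moment_exp eta0 aC) _.
      by rewrite lee_fin ler_wpM2r ?expR_ge0.
    have bpos : 0 < 2 * a by rewrite mulr_gt0// (lt_trans eC0).
    have q1 : 1 <= 2 * r by lra.
    apply: le_trans (tail_moment _ q1 bpos) _; first by rewrite lexx; lra.
    rewrite lee_fin subr0 ler_pdivrMr ?powR_gt0//.
    have -> : 2 * r * Cmo = 2 * a * (expR (-1)).
      by rewrite expRN /r; field; rewrite !gt_eqF ?expR_gt0.
    rewrite powRM ?expR_ge0 ?(ltW bpos)// mulrC ler_wpM2r ?powR_ge0//.
    by rewrite {1}/powR gt_eqF ?expR_gt0// expRK mulrN1.
  rewrite -EFinM lee_fin /B -[leRHS]mulrA ler_wpM2l ?mulr_ge0//.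
  (* The two tails are s^4 and D s^2, and s^3 + s <= 1 for s <= 2/3: halving the exponent from r to
     r / 2 absorbs their sum. *)
  set s := expR (- (r / 2)).
  have s0 : 0 < s by exact: expR_gt0.
  have s23 : s <= 2 / 3.
    by apply: le_trans expRN_half_le; rewrite ler_expR; lra.
  have -> : expR (- (2 * r)) = s ^+ 4 by rewrite -expRM_natl; congr expR; field.
  have -> : expR (- r) = s ^+ 2 by rewrite -expRM_natl; congr expR; field.
  have s2 : s ^+ 2 <= 4 / 9 by rewrite expr2; nra.
  have h : s ^+ 4 + s ^+ 2 <= s.
    have -> : s ^+ 4 + s ^+ 2 = s * (s * (s ^+ 2 + 1)) by ring.
    by rewrite ler_piMr ?(ltW s0)//; nra.
  apply: (@le_trans _ _ (D * (s ^+ 4 + s ^+ 2))).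
    by rewrite mulrDr lerD2r ler_peMl// exprn_ge0// ltW.
  by rewrite ler_wpM2l// (le_trans ler01).
have B0 : 0 <= B by rewrite -lee_fin; apply: le_trans key; exact: integral_ge0.
have ig : P.-integrable [set: T] (EFin \o (fun w => f (X0 w) * b0 (X0 w))).
  by apply/integrableP; split => //; apply: le_lt_trans key (ltry _).
apply: le_trans (le_normr_Rintegral measurableT ig) _.
rewrite /Rintegral -lee_fin fineK//.
by rewrite ge0_fin_numE ?integral_ge0//; apply: le_lt_trans key (ltry _).
Qed.

End initial_mean.

(** * Geometry of the shells *)

Section shells.
Context (R : realType).
Variables (L S : R).
Hypotheses (S0 : 0 < S) (SL : S < L).
Implicit Types f : R -> R.

Let L0 : 0 < L. Proof. exact: lt_trans SL. Qed.

Lemma nonzero_supp f x : f x != 0 -> supp f x.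
Proof. by move=> fx; exact: subset_closure. Qed.

Lemma bands_cover (x : R) : exists k : nat,
  (`](- (2 * k.+1%:R * L)), (- (2 * k%:R * L))]
     `|` `](2 * k%:R * L), (2 * k.+1%:R * L)]) x.
Proof.
have L20 : 0 < 2 * L by rewrite mulr_gt0.
have tr (y : R) : 0 <= y -> exists k : nat, 2 * k%:R * L <= y < 2 * k.+1%:R * L.
  move=> y0; exists (Num.truncn (y / (2 * L))).
  have /andP[h1 h2] := truncn_itv (divr_ge0 y0 (ltW L20)).
  rewrite ler_pdivlMr// in h1; rewrite ltr_pdivrMr// in h2.
  by apply/andP; split; rewrite mulrAC mulrC.
have [x0|x0] := leP x 0.
  have [k /andP[h1 h2]] := tr (- x) ltac:(by rewrite oppr_ge0).
  by exists k; left; rewrite /= in_itv/=; apply/andP; split; lra.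
have [k /andP[h1 h2]] := tr x (ltW x0).
(* Positive bands exclude their inner end: x = 2 k L belongs to the band of index k - 1, and k = 0
   would force x = 0. *)
move: h1; rewrite le_eqVlt => /predU1P[h1|h1]; last first.
  by exists k; right; rewrite /= in_itv/= h1 ltW.
case: k h1 h2 => [|k] h1 h2; first by move: x0; rewrite -h1 mulr0 mul0r ltxx.
exists k; right; rewrite /= in_itv/= -h1 lexx andbT.
by rewrite ltr_pM2r// ltr_pM2l// ltr_nat.
Qed.

(** All points of the support are within S of any chosen one, hence in the widened band of that one.
    An empty support fits any shell. *)
Lemma supp_in_shell f (a b : R) : supp f `<=` `[a, b] -> `|b - a| <= S ->
  exists k, supp f `<=` shell L S k.
Proof.
move=> fab baS; have [[x sx]|nsx] := pselect (exists x, supp f x); last first.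
  by exists 0%N => y sy; exfalso; apply: nsx; exists y.
have [k xk] := bands_cover x; exists k => y sy.
exists x => //; exists (y - x); last by rewrite addrC subrK.
have := fab _ sx; have := fab _ sy; rewrite /= !in_itv/= => /andP[y1 y2] /andP[x1 x2].
move: baS; rewrite ler_norml => /andP[_ baS].
by apply/andP; split; lra.
Qed.

Lemma shell_far k y : shell L S k y -> 2 * k%:R * L - S <= `|y|.
Proof.
move=> [x hx [z]]; rewrite /= in_itv/= => /andP[z1 z2] <-.
have k0 : 0 <= 2 * k%:R * L by rewrite !mulr_ge0// ltW.
rewrite ler_normr; case: hx; rewrite /= in_itv/= => /andP[h1 h2].
  by apply/orP; right; lra.
by apply/orP; left; lra.
Qed.

(** For k >= 1, S < L <= k L, so the inner radius 2 k L - S still exceeds k L. *)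
Lemma supp_shell_far f k x : (0 < k)%N -> supp f `<=` shell L S k ->
  `|x| < k%:R * L -> f x = 0.
Proof.
move=> k0 fk xk; apply/eqP/negPn/negP => /nonzero_supp/fk/shell_far.
have : 1 * L <= k%:R * L by rewrite ler_wpM2r ?(ltW L0)// ler1n.
have := SL; rewrite -mulrA; lra.
Qed.

(** A nonzero value at |x| < 2 L would place the whole support within S of x, that is inside shell
    0. *)
Lemma supp_notin_shell0 f (a b x : R) : supp f `<=` `[a, b] ->
  `|b - a| <= S -> ~ supp f `<=` shell L S 0 -> `|x| < 2 * L -> f x = 0.
Proof.
move=> fab baS nf xL; apply/eqP/negPn/negP => /nonzero_supp sx; apply: nf => y sy.
have := fab _ sx; have := fab _ sy; rewrite /= !in_itv/= => /andP[y1 y2] /andP[x1 x2].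
move: baS; rewrite ler_norml => /andP[_ baS].
move: xL; rewrite ltr_norml => /andP[xL1 xL2].
rewrite /shell /= mulr0 mul0r oppr0 mulr1.
(* The band is open at -2 L, so the base point there is y + S; on the other side the closed end 2 L
   serves. *)
have [yL|yL] := leP y (- (2 * L)).
  exists (y + S); last by exists (- S); [rewrite /= in_itv/=; lra|rewrite addrK].
  left; rewrite /= in_itv/=; apply/andP; split; have := SL; have := L0; lra.
have [yL'|yL'] := leP y (2 * L); last first.
  exists (2 * L); first by right; rewrite /= in_itv/= lexx andbT mulr_gt0.
  exists (y - 2 * L); last by rewrite addrC subrK.
  by rewrite /= in_itv/=; apply/andP; split; lra.
exists y; last by exists 0; [rewrite /= in_itv/=; lra|rewrite addr0].
have [y0|y0] := leP y 0; first by left; rewrite /= in_itv/= yL y0.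
by right; rewrite /= in_itv/= y0 yL'.
Qed.

End shells.

(** * From a pointwise domination to the norm of the supremum *)

Section domination.
Context (R : realType) d (T : measurableType d) (P : probability T R).
Context (J : Type) (F : set J) (H : nat -> set J) (dist : J -> J -> \bar R).
Variables (Z Rm G : J -> T -> R) (A : nat -> set T) (kappa : J -> nat).
Variables (alpha v p rho c : R).
Hypotheses (alpha0 : 0 < alpha) (v0 : 0 <= v) (p1 : 1 <= p) (rho0 : 0 <= rho)
  (c0 : 0 <= c).
Hypotheses (cF : countable F) (HF : forall k, H k `<=` F)
  (Hkappa : forall f, F f -> H (kappa f) f).
Hypotheses (mZ : forall f, F f -> measurable_fun [set: T] (Z f))
  (mR : forall f, F f -> measurable_fun [set: T] (Rm f)).
Hypothesis normZ : forall f r, F f -> 1 <= r ->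
  ('N[P]_r%:E[EFin \o Z f] <= (r `^ alpha^-1 * v)%:E)%E.
Hypothesis distZ : forall f g (r u : R), F f -> F g -> 1 <= r -> 0 <= u ->
  (dist f g < u%:E)%E ->
  ('N[P]_r%:E[EFin \o (Z f \- Z g)%R] <= (r `^ alpha^-1 * u)%:E)%E.
Hypothesis normR : forall n (e : 'I_n -> J), (forall i, F (e i)) ->
  ('N[P]_p%:E[EFin \o maxabs xpredT (Rm \o e)] <= rho%:E)%E.
Hypotheses (mA : forall k, measurable (A k))
  (PA : forall k, (P (A k) <= (expR (- (k%:R / 2)) `^ (2 * p))%:E)%E).
Hypothesis dom : forall f, F f -> {ae P, forall w,
  `|G f w| <= \1_(A (kappa f)) w * `|Z f w| + `|Rm f w| + c}.

Let esum_H : \bar R :=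
  (\sum_(0 <= k <oo) entropy_integral (H k) dist alpha * (expR (- (k%:R / 2)))%:E)%E.
Hypothesis finE : (esum_H < +oo)%E.

Let p0 : 0 < p. Proof. exact: lt_le_trans p1. Qed.
Let K := chaining_constant alpha.
Let E k := fine (entropy_integral (H k) dist alpha).

Let K0 : 0 <= K.
Proof. by rewrite /K /chaining_constant mulr_ge0// invr_ge0 powR_ge0. Qed.

Let EI0 k : (0 <= entropy_integral (H k) dist alpha)%E.
Proof. by apply: integral_ge0 => x _; exact: poweR_ge0. Qed.

Let term_ge0 k : (0 <= entropy_integral (H k) dist alpha * (expR (- (k%:R / 2)))%:E)%E.
Proof. by rewrite mule_ge0// lee_fin expR_ge0. Qed.

Let partial_le m :
  (\sum_(k < m) entropy_integral (H k) dist alpha * (expR (- (k%:R / 2)))%:E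
    <= esum_H)%E.
Proof.
rewrite /esum_H -(big_mkord xpredT (fun k => entropy_integral (H k) dist alpha *
  (expR (- (k%:R / 2)))%:E)%E).
by apply: nneseries_lim_ge => k _ _; exact: term_ge0.
Qed.

Let EI_fin k : (entropy_integral (H k) dist alpha < +oo)%E.
Proof.
rewrite ltey; apply/eqP => Ey; have := partial_le k.+1.
rewrite big_ord_recr/= Ey gt0_mulye ?lte_fin ?expR_gt0// addey.
  by rewrite leye_eq => /eqP h; move: finE; rewrite h ltxx.
by rewrite -ltNye; apply: lt_le_trans (sume_ge0 _ _).
Qed.

Let EE k : entropy_integral (H k) dist alpha = (E k)%:E.
Proof. by rewrite /E fineK// ge0_fin_numE. Qed.

Let E0 k : 0 <= E k.
Proof. by rewrite -lee_fin -EE. Qed.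

Let geometric_le m : \sum_(k < m) expR (- (k%:R / 2)) <= 3 :> R.
Proof.
pose s : R := expR (- 2^-1).
have s0 : 0 < s by exact: expR_gt0.
have s23 : s <= 2 / 3 by exact: expRN_half_le.
(* The remainder 3 s^m makes the induction close; its step is 3 s <= 2. *)
suff : \sum_(k < m) expR (- (k%:R / 2)) <= 3 * (1 - s ^+ m) :> R.
  move=> /le_trans; apply.
  by rewrite ler_piMr// lerBlDr lerDl exprn_ge0// ltW.
elim: m => [|m IH]; first by rewrite big_ord0 expr0 subrr mulr0.
rewrite big_ord_recr/=.
have -> : expR (- (m%:R / 2)) = s ^+ m.
  by rewrite /s -expRM_natl; congr expR; rewrite mulrN.
have sm0 : 0 < s ^+ m by rewrite exprn_gt0.
have := lerD IH (lexx (s ^+ m)); move=> /le_trans; apply.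
rewrite exprS; nra.
Qed.

Lemma Lnorm_sum_le m (g : nat -> T -> R) (b : nat -> R) :
  (forall k, measurable_fun [set: T] (g k)) ->
  (forall k, ('N[P]_p%:E[EFin \o g k] <= (b k)%:E)%E) ->
  ('N[P]_p%:E[EFin \o (fun w => \sum_(k < m) g k w)%R] <= (\sum_(k < m) b k)%:E)%E.
Proof.
move=> mg gb; elim: m => [|m IH].
  rewrite big_ord0 (_ : _ \o _ = cst 0%E); last first.
    by apply/funext => w; rewrite /= big_ord0.
  by rewrite Lnorm0// eqe gt_eqF.
rewrite big_ord_recr/= EFinD (_ : EFin \o _ =
    EFin \o ((fun w => \sum_(k < m) g k w) \+ g m)); last first.
  by apply/funext => w; rewrite /= big_ord_recr.
apply: le_trans (minkowski_EFin _ _ _ p1) _ => //.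
  by apply: measurable_sum => i; exact: mg.
exact: leeD.
Qed.

Let total : R := K * fine esum_H + (6 * ((2 * p) `^ alpha^-1 * v) + rho + c).

Let esum_ge0 : (0 <= esum_H)%E.
Proof. by apply: nneseries_ge0 => k _ _; exact: term_ge0. Qed.

Let total_ge0 : 0 <= total.
Proof.
rewrite /total; apply: addr_ge0; first by apply: mulr_ge0 => //; exact: fine_ge0.
by rewrite !addr_ge0 ?mulr_ge0 ?powR_ge0.
Qed.

Let dominant f w := \1_(A (kappa f)) w * `|Z f w| + `|Rm f w| + c.

Let dominant_ge0 f w : 0 <= dominant f w.
Proof. by rewrite !addr_ge0// mulr_ge0. Qed.

Let measurable_dominant f : F f -> measurable_fun [set: T] (dominant f).
Proof.
move=> Ff; apply: measurable_funD; last exact: measurable_cst.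
apply: measurable_funD; last by apply: measurableT_comp => //; exact: mR.
apply: measurable_funM; first exact: measurable_indic.
by apply: measurableT_comp => //; exact: mZ.
Qed.

(** A finite family is assigned to finitely many classes, all of index below [m], so the maximum is
    at most a finite sum over classes. Each class is chained at order 2 p. *)
Let finite_bound n (e : 'I_n -> J) : (forall i, F (e i)) ->
  ('N[P]_p%:E[EFin \o maxabs xpredT (dominant \o e)] <= total%:E)%E.
Proof.
move=> Fe; pose m := (\max_(i < n) kappa (e i)).+1.
pose B k := maxabs [pred i | kappa (e i) == k] (Z \o e).
have mB k : measurable_fun [set: T] (B k).
  by apply: measurable_maxabs => i _; exact: mZ.
have p21 : 1 <= 2 * p by rewrite mulr_ege1// ler1n.
have chain k : ('N[P]_(2 * p)%:E[EFin \o B k] <=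
    (2 * ((2 * p) `^ alpha^-1 * v) + K * E k)%:E)%E.
  rewrite EFinD [(K * _)%:E]EFinM -EE; apply: (@Lnorm_maxabs_entropy _ _ _ P J (H k) dist) => //.
  - by move=> f /HF; exact: mZ.
  - by move=> f r /HF; exact: normZ.
  - by move=> f g r u /HF Ff /HF; exact: distZ.
  - by move=> i /= /eqP <-; exact: Hkappa.
pose g k w := \1_(A k) w * B k w.
have mg k : measurable_fun [set: T] (g k).
  by apply: measurable_funM => //; exact: measurable_indic.
have gk k : ('N[P]_p%:E[EFin \o g k] <=
    (expR (- (k%:R / 2)) * (2 * ((2 * p) `^ alpha^-1 * v) + K * E k))%:E)%E.
  apply: Lnorm_indic_le => //; rewrite ?expR_ge0//; last exact: PA.
  by apply: addr_ge0; [rewrite !mulr_ge0 ?powR_ge0|exact: mulr_ge0].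
pose Sg w := \sum_(k < m) g k w.
pose Rn := maxabs xpredT (Rm \o e).
have mSg : measurable_fun [set: T] Sg by apply: measurable_sum => k; exact: mg.
have mRn : measurable_fun [set: T] Rn.
  by apply: measurable_maxabs => i _; exact: mR.
have g0 k w : 0 <= g k w by rewrite mulr_ge0 ?maxabs_ge0.
have Sg0 w : 0 <= Sg w by rewrite sumr_ge0.
apply: (@le_trans _ _ ('N[P]_p%:E[EFin \o ((Sg \+ Rn) \+ cst c)%R])%E).
  apply: le_Lnorm => // w.
  have S0 : 0 <= Sg w + Rn w + c by rewrite !addr_ge0 ?maxabs_ge0.
  rewrite /= lee_fin (ger0_norm (maxabs_ge0 _ _ _)) (ger0_norm S0).
  apply: maxabs_le => // i _; rewrite /= (ger0_norm (dominant_ge0 _ _)).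
  rewrite lerD2r; apply: lerD; last exact: (le_maxabs (A := xpredT) (Rm \o e)).
  have km : (kappa (e i) < m)%N.
    by rewrite ltnS; exact: (leq_bigmax (F := fun i => kappa (e i))).
  rewrite /Sg (bigD1 (Ordinal km))//= -[leLHS]addr0; apply: lerD.
    by apply: ler_wpM2l => //; apply: (le_maxabs (Z \o e)) => /=.
  by rewrite sumr_ge0.
have mSR : measurable_fun [set: T] (Sg \+ Rn) by exact: measurable_funD.
apply: le_trans (minkowski_EFin P mSR (measurable_cst _) p1) _.
apply: le_trans (leeD (minkowski_EFin P mSg mRn p1) (lexx _)) _.
have Hc : ('N[P]_p%:E[EFin \o cst c] <= c%:E)%E.
  apply/Lnorm_leP => //.
  have -> : (\int[P]_x `|(EFin \o cst c) x| `^ p = \int[P]_x cst (c `^ p)%:E x)%E.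
    by apply: eq_integral => x _; rewrite /= ger0_norm.
  by rewrite integral_cst// [X in (_ * X)%E]probability_setT mule1.
apply: le_trans (leeD (leeD (Lnorm_sum_le m mg gk) (normR Fe)) Hc) _.
rewrite -!EFinD lee_fin /total !addrA !lerD2r.
have -> : \sum_(k < m) expR (- (k%:R / 2)) * (2 * ((2 * p) `^ alpha^-1 * v) + K * E k)
  = K * (\sum_(k < m) E k * expR (- (k%:R / 2)))
    + (\sum_(k < m) expR (- (k%:R / 2))) * (2 * ((2 * p) `^ alpha^-1 * v)).
  rewrite mulr_sumr mulr_suml -big_split/=; apply: eq_bigr => k _; ring.
apply: lerD.
  rewrite ler_wpM2l// -lee_fin fineK ?ge0_fin_numE//.
  apply: le_trans (partial_le m); rewrite -sumEFin; apply: lee_sum => k _.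
  by rewrite EE.
have h : 0 <= 2 * ((2 * p) `^ alpha^-1 * v) by rewrite !mulr_ge0 ?powR_ge0.
apply: le_trans (ler_wpM2r h (geometric_le m)) _; lra.
Qed.

(** Each f has its own exceptional null set; countability of [F] merges them. The maxima of the
    dominants over initial segments of an enumeration increase, so the uniform finite bound passes
    to the limit. *)
Lemma Lnorm_sup_abs_le :
  ('N[P]_p%:E[sup_abs F G] <=
    K%:E * esum_H + (6 * ((2 * p) `^ alpha^-1 * v) + rho + c)%:E)%E.
Proof.
have -> : (K%:E * esum_H + (6 * ((2 * p) `^ alpha^-1 * v) + rho + c)%:E = total%:E)%E.
  by rewrite /total [RHS]EFinD [(K * _)%:E]EFinM fineK// ge0_fin_numE.
have [F0|/set0P[f0 Ff0]] := eqVneq F set0.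
  rewrite (_ : sup_abs F G = cst 0%E) ?Lnorm0 ?lee_fin// ?eqe ?gt_eqF//.
  apply/funext => w; rewrite /sup_abs F0 image_set0 setU0.
  by rewrite ereal_sup1.
have [e eF] : exists e : nat -> J, F = range e.
  have /pfcard_geP[F0|[e]] := cF.
    by exfalso; move: Ff0; rewrite F0.
  exists (fun n => if e n \in F then e n else f0); apply/seteqP; split.
    move=> f Ff; have [n _ en] := @surj _ _ _ _ e _ Ff.
    by exists n => //=; rewrite en mem_set.
  by move=> _ [n _ <-]; case: ifPn => // /set_mem.
have Fe n : F (e n) by rewrite eF; exists n.
pose g n w := (maxabs xpredT (dominant \o (fun i : 'I_n => e i)) w)%:E.
have mg n : measurable_fun [set: T] (g n).
  apply/measurable_EFinP; apply: measurable_maxabs => i _.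
  exact: measurable_dominant.
pose h w := esups (g^~ w) 0.
have mh : measurable_fun [set: T] h by exact: measurable_fun_esups.
have hE w : h w = ereal_sup (range (g^~ w)).
  by congr ereal_sup; apply/seteqP; split => _ [n _ <-]; exists n.
have h0 w : (0 <= h w)%E.
  rewrite hE; apply: le_trans (_ : g 0%N w <= _)%E; last first.
    by apply: ereal_sup_ubound; exists 0%N.
  by rewrite lee_fin maxabs_ge0.
apply: (@le_trans _ _ ('N[P]_p%:E[h])%E).
  apply: le_Lnorm_ae => //.
  have aedom : {ae P, forall w n, `|G (e n) w| <= dominant (e n) w}.
    by apply/ae_foralln => n; exact: dom.
  apply: filterS aedom => w Hw.
  have s0 : (0 <= sup_abs F G w)%E by apply: ereal_sup_ubound; left.
  rewrite !gee0_abs//; apply: ge_ereal_sup => _ [->//|[f Ff <-]].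
  move: Ff; rewrite eF => -[n _ <-].
  (* [g n] involves indices below n only, so [e n] first appears in [g n.+1]. *)
  rewrite hE; apply: (@le_trans _ _ (g n.+1 w)); last first.
    by apply: ereal_sup_ubound; exists n.+1.
  rewrite lee_fin; apply: le_trans (Hw n) _.
  have := le_maxabs (A := xpredT) (i := @ord_max n)
    (dominant \o (fun i : 'I_n.+1 => e i)) w isT.
  by rewrite /= (ger0_norm (dominant_ge0 _ _)).
apply: (@Lnorm_le_sup _ _ _ P p total g) => //.
- by move=> n w; rewrite lee_fin maxabs_ge0.
- move=> w m n mn; rewrite lee_fin; apply: maxabs_le => [|i _].
    exact: maxabs_ge0.
  exact: (le_maxabs (A := xpredT) (i := widen_ord mn i)
    (dominant \o (fun i : 'I_n => e i)) w isT).
- by move=> w; rewrite gee0_abs// hE.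
- by move=> n; exact: finite_bound.
Qed.

End domination.

(** * Application to the empirical process *)

Lemma empirical_process_vanish (R : realType) d (T : measurableType d)
    (P : probability T R) (X : R -> T -> R) (b0 f : R -> R) (t m : R) w :
  0 < t -> (forall u, 0 <= u <= t -> f (X u w) = 0) ->
  `| \int[P]_w' (f (X 0 w') * b0 (X 0 w')) | <= m ->
  `|empirical_process P X b0 f t w| <= Num.sqrt t * m.
Proof.
move=> t0 fX mb; have s0 : 0 < Num.sqrt t by rewrite sqrtr_gt0.
rewrite /empirical_process; pose I := \int[P]_w' (f (X 0 w') * b0 (X 0 w')).
rewrite (@eq_Rintegral _ _ _ _ _ (cst (- I))); last first.
  by move=> u; rewrite inE/= in_itv/= => ut; rewrite fX// mul0r sub0r.
rewrite Rintegral_cst//= [X in fine X]lebesgue_measure_itv/= lte_fin t0 -EFinB/= subr0.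
rewrite -/I in mb *; rewrite !normrM normfV normrN (gtr0_norm t0) (gtr0_norm s0).
have -> : (Num.sqrt t)^-1 * (`|I| * t) = Num.sqrt t * `|I|.
  rewrite -{2}(sqr_sqrtr (ltW t0)); field; rewrite gt_eqF//.
by rewrite ler_wpM2l// ltW.
Qed.

Theorem theorem3 (R : realType) (alpha : R) (halpha : 0 < alpha) :
  exists2 Calpha : R, 0 < Calpha &
  forall (d : measure_display) (Omega : measurableType d)
    (P : probability Omega R) (Fil : R -> set (set Omega))
    (X M V Q : R -> Omega -> R) (phi1 phi2 : R -> R) (Cmo cbar : R)
    (b0 : R -> R) (eta C : R)
    (F : set (R -> R)) (U VV S : R)
    (Mf Rf : (R -> R) -> R -> Omega -> R) (Psi1 Psi2 lambda : R),
  let c := Num.max 1 (Num.sqrt 2 * cbar) in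
  let Lam := Lambda lambda c phi1 phi2 in
  let G := empirical_process P X b0 in
  complete_filtration P Fil ->
  continuous_semimartingale P Fil X M V ->
  quadratic_variation P Fil M Q ->
  moment_assumption P X V Q phi1 phi2 ->
  0 < Cmo ->
  (forall p : R, 1 <= p -> ('N[P]_p%:E[EFin \o X 0%R] <= (p * Cmo)%:E)%E) ->
  BDG_constant P Fil cbar ->
  0 <= eta -> 1 <= C ->
  measurable_fun [set: R] b0 ->
  (forall x : R, `|b0 x| <= C * (1 + `|x| `^ eta)) ->
  0 < U -> 0 < VV -> 0 < S -> VV <= Num.sqrt S ->
  countable F ->
  (forall f, F f ->
    [/\ measurable_fun [set: R] f,
        forall x : R, `|f x| <= U,
        (L2norm f <= VV%:E)%E &
        exists a b : R, [/\ a < b, supp f `<=` `[a, b] & `|b - a| <= S]]) ->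
  0 <= Psi1 -> 0 <= Psi2 ->
  (forall f, F f ->
    [/\ martingale P Fil (Mf f),
        {ae P, forall w, Mf f 0 w = 0},
        forall t : R, 0 <= t -> measurable_fun [set: Omega] (Rf f t) &
        forall t : R, 0 < t -> {ae P, forall w,
          G f t w = (Num.sqrt t)^-1 * Mf f t w
                    + (Num.sqrt t)^-1 * Rf f t w}]) ->
  (forall f (p t : R), F f -> 1 <= p -> 0 < t ->
    ('N[P]_p%:E[EFin \o Mf f t]
     <= (Psi1 * Num.sqrt t * p `^ alpha^-1)%:E * L2norm f)%E) ->
  (forall p t : R, 1 <= p -> 0 < t ->
    ('N[P]_p%:E[sup_abs F (fun f => Rf f t)] <= (Psi2 * p)%:E)%E) ->
  (forall f g (p t : R), F f -> F g -> 1 <= p -> 0 < t ->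
    ('N[P]_p%:E[EFin \o (Mf f t \- Mf g t)%R]
     <= (Psi1 * Num.sqrt t * p `^ alpha^-1)%:E * L2norm (f \- g)%R)%E) ->
  1 < lambda ->
  (forall p t : R, 1 <= p -> 1 <= t ->
    Num.max S (expR 1 * Cmo) < p * Lam t) ->
  forall p t : R, 1 <= p -> 1 <= t ->
  (entropy_sum F (p * Lam t) S Psi1 alpha < +oo)%E ->
  ('N[P]_p%:E[sup_abs F (fun f => G f t)]
   <= Calpha%:E * entropy_sum F (p * Lam t) S Psi1 alpha
      + (6 * Psi1 * (2 * p) `^ alpha^-1 * VV + 2 * Psi2 * p / Num.sqrt t
         + Num.sqrt t * C * U * (1 + 2 * eta * Cmo) `^ eta
           * expR (- (Lam t / (2 * expR 1 * Cmo))))%:E)%E.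
Proof.
exists (chaining_constant alpha).
  by rewrite /chaining_constant mulr_gt0// invr_gt0 powR_gt0// ln_gt0// ltr1n.
move=> d Omega P Fil X M V Q phi1 phi2 Cmo cbar b0 eta C F U VV S Mf Rf Psi1 Psi2.
move=> lambda c Lam G fil smX qvM momX Cmo0 momX0 bdg eta0 C1 mb0 b0C U0 VV0 S0 _ cF.
move=> HF Psi10 Psi20 decG normM normR normMM l1 HLam p t p1 t1 finE.
have t0 : 0 < t by exact: lt_le_trans t1.
have t0' := ltW t0.
have p0 : 0 < p by exact: lt_le_trans p1.
have st0 : 0 < Num.sqrt t by rewrite sqrtr_gt0.
have sti0 : 0 <= (Num.sqrt t)^-1 by rewrite invr_ge0 ltW.
have C0 : 0 <= C by exact: le_trans C1.
pose L := p * Lam t.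
have SL : S < L by apply: le_lt_trans (HLam p t p1 t1); rewrite le_max lexx.
have CLam : expR 1 * Cmo < Lam t.
  have := HLam 1 t (lexx 1) t1; rewrite mul1r; apply: le_lt_trans.
  by rewrite le_max lexx orbT.
have Lam0 : 0 < Lam t by apply: lt_trans CLam; rewrite mulr_gt0 ?expR_gt0.
have LamL : Lam t <= L by rewrite /L ler_peMl// ltW.
pose m := C * U * (1 + 2 * eta * Cmo) `^ eta
          * expR (- (Lam t / (2 * expR 1 * Cmo))).
have m0 : 0 <= m.
  by rewrite /m !mulr_ge0 ?powR_ge0 ?expR_ge0// ltW.
have mM f : F f -> measurable_fun [set: Omega] (Mf f t).
  move=> Ff; case: (decG f Ff) => -[aM _ _] _ _ _.
  exact: (adapted_measurable fil aM t0').
have mR f : F f -> measurable_fun [set: Omega] (Rf f t).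
  by move=> Ff; case: (decG f Ff) => _ _ mR _; exact: mR.
(* Index 0 is taken whenever possible; any other index certifies that f is not in F_0. *)
have /choice[kappa Hk] : forall f, exists k, F f ->
    subclass F L S k f /\ (k = 0%N \/ ~ supp f `<=` shell L S 0).
  move=> f.
  have [Ff|] := pselect (F f); last by exists 0%N.
  have [f0|nf0] := pselect (supp f `<=` shell L S 0).
    by exists 0%N => _; split => //; left.
  have [_ _ _ [a [b [_ fab baS]]]] := HF f Ff.
  have [k fk] := supp_in_shell S0 SL fab baS.
  by exists k => _; split => //; right.
(* Class 0 gets the whole space, of probability 1 = exp(0), since its functions need not vanish
   along the path. *)
pose A k := if k is 0%N then [set: Omega]
            else [set w | k%:R * L <= `|path_bound X M V t w|].
have mpb := measurable_path_bound fil smX t0'.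
have mA k : measurable (A k).
  case: k => [|k]; first exact: measurableT.
  have := measurableT_comp (@normr_measurable R setT) mpb.
  move=> /(_ measurableT `[k.+1%:R * L, +oo[%classic (measurable_itv _)).
  rewrite setTI; suff -> : A k.+1 = (Num.norm \o path_bound X M V t) @^-1`
    `[k.+1%:R * L, +oo[%classic by [].
  by apply/seteqP; split => x /=; rewrite in_itv/= andbT.
have PA k : (P (A k) <= (expR (- (k%:R / 2)) `^ (2 * p))%:E)%E.
  case: k => [|k]; first by rewrite mul0r oppr0 expR0 powR1 [leLHS]probability_setT.
  exact: (prob_path_bound fil smX qvM momX bdg l1 p1 t0 (ltn0Sn k)).
pose Z (f : R -> R) w := (Num.sqrt t)^-1 * Mf f t w.
pose Rm (f : R -> R) w := (Num.sqrt t)^-1 * Rf f t w.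
have L20 (f : R -> R) : (0 <= L2norm f)%E by exact: Lnorm_ge0.
have dom f : F f -> {ae P, forall w, `|G f t w| <=
    \1_(A (kappa f)) w * `|Z f w| + `|Rm f w| + Num.sqrt t * m}.
  move=> Ff; have [_ _ _ /(_ t t0)] := decG f Ff; apply: filterS => w Gw.
  have c0 : 0 <= Num.sqrt t * m by rewrite mulr_ge0// ltW.
  have [[_ fk] k0] := Hk f Ff.
  rewrite indicE; have [_|] := boolP (w \in A (kappa f)).
    rewrite mul1r Gw; apply: le_trans (ler_normD _ _) _.
    by rewrite lerDl.
  move=> wA; rewrite mul0r add0r; apply: ler_wpDl => //.
  have kpos : (0 < kappa f)%N.
    by move: wA; rewrite lt0n; apply: contraNneq => ->; rewrite in_setT.
  have nf0 : ~ supp f `<=` shell L S 0.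
    by case: k0 => // k0; move: kpos; rewrite k0.
  have [mf fU _ [a [b [_ fab baS]]]] := HF f Ff.
  apply: empirical_process_vanish => // [u ut|].
    apply: (supp_shell_far S0 SL kpos fk).
    apply: le_lt_trans (le_path_bound smX w ut) _.
    apply: le_lt_trans (ler_norm _) _.
    move: wA; rewrite notin_setE /A; case: (kappa f) kpos => // k _ /negP.
    by rewrite -ltNge.
  apply: (initial_mean_le (measurable_X0 fil smX)) => //; [exact: ltW|].
  move=> x xL; apply: (supp_notin_shell0 S0 SL fab baS nf0).
  by apply: lt_le_trans xL _; rewrite ler_wpM2l.
apply: le_trans (Lnorm_sup_abs_le (F := F) (H := subclass F L S)
  (dist := scaled_L2dist (expR 1 * Psi1)) (Z := Z) (Rm := Rm) (A := A)
  (kappa := kappa) (alpha := alpha) (v := Psi1 * VV) (p := p)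
  (rho := 2 * Psi2 * p / Num.sqrt t) (c := Num.sqrt t * m)
  halpha _ p1 _ _ cF _ _ _ _ _ _ _ mA PA dom finE) _.
- by rewrite mulr_ge0// ltW.
- by rewrite !mulr_ge0// ltW.
- by rewrite mulr_ge0// ltW.
- by move=> k f [].
- by move=> f Ff; case: (Hk f Ff).
- by move=> f Ff; apply: measurable_funM => //; exact: mM.
- by move=> f Ff; apply: measurable_funM => //; exact: mR.
- move=> f r Ff r1; have r0 : 0 < r by exact: lt_le_trans r1.
  have -> : r `^ alpha^-1 * (Psi1 * VV) =
      (Num.sqrt t)^-1 * (Psi1 * Num.sqrt t * r `^ alpha^-1 * VV).
    by field; rewrite gt_eqF.
  have ? : 0 <= Psi1 * Num.sqrt t * r `^ alpha^-1.
    by rewrite !mulr_ge0 ?powR_ge0// ltW.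
  apply: Lnorm_scale_le => //; [exact: mM|by rewrite mulr_ge0// ltW|].
  apply: le_trans (normM f r t Ff r1 t0) _; rewrite [leRHS]EFinM.
  by apply: lee_wpmul2l => //; case: (HF f Ff).
- move=> f g r u Ff Fg r1 u0 fgu; have r0 : 0 < r by exact: lt_le_trans r1.
  rewrite (_ : _ \o _ = EFin \o (fun w => (Num.sqrt t)^-1 * (Mf f t \- Mf g t) w)); last first.
    by apply/funext => w; rewrite /= /Z mulrBr.
  have -> : r `^ alpha^-1 * u = (Num.sqrt t)^-1 * (Num.sqrt t * r `^ alpha^-1 * u).
    by field; rewrite gt_eqF.
  have sr0 : 0 <= Num.sqrt t * r `^ alpha^-1 by rewrite mulr_ge0 ?powR_ge0// ltW.
  apply: Lnorm_scale_le => //; [|by rewrite mulr_ge0|].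
    by apply: measurable_funB; exact: mM.
  apply: le_trans (normMM f g r t Ff Fg r1 t0) _.
  rewrite -mulrA mulrC [X in (X * _)%E]EFinM -muleA [leRHS]EFinM.
  apply: lee_wpmul2l => //.
  (* The entropy metric carries e Psi1, and the increments are bounded with Psi1 <= e Psi1. *)
  apply: le_trans (ltW fgu); rewrite /scaled_L2dist; apply: lee_wpmul2r => //.
  by rewrite lee_fin ler_peMl// -expR0 ler_expR.
- move=> n e Fe.
  have mmR : measurable_fun [set: Omega] (maxabs xpredT ((fun f => Rf f t) \o e)).
    by apply: measurable_maxabs => i _; exact: mR.
  apply: (@le_trans _ _ ('N[P]_p%:E[EFin \o
      (fun w => (Num.sqrt t)^-1 * maxabs xpredT ((fun f => Rf f t) \o e) w)%R])%E).
    apply: le_Lnorm => // w; rewrite /= lee_fin (ger0_norm (maxabs_ge0 _ _ _)).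
    rewrite (ger0_norm (mulr_ge0 sti0 (maxabs_ge0 _ _ _))).
    apply: maxabs_le => [|i _]; first by rewrite mulr_ge0 ?maxabs_ge0.
    rewrite /= /Rm normrM (ger0_norm sti0) ler_wpM2l//.
    exact: (le_maxabs (A := xpredT) (i := i) ((fun f => Rf f t) \o e) w isT).
  apply: (@le_trans _ _ ((Num.sqrt t)^-1 * (Psi2 * p))%:E); last first.
    have h : 0 <= Psi2 * p by rewrite mulr_ge0// ltW.
    by rewrite lee_fin mulrC ler_wpM2r// -mulrA ler_peMl// ler1n.
  apply: Lnorm_scale_le => //; first by rewrite mulr_ge0// ltW.
  apply: le_trans (normR p t p1 t0); apply: le_Lnorm => // w.
  rewrite /= (ger0_norm (maxabs_ge0 _ _ _)); apply: le_trans (lee_abs _).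
  rewrite /maxabs; elim/big_ind : _ => [|x y Hx Hy|i _].
  - by apply: ereal_sup_ubound; left.
  - by rewrite /Num.max; case: ifP.
  - by apply: ereal_sup_ubound; right; exists (e i).
apply: leeD => //; rewrite lee_fin le_eqVlt; apply/orP; left; apply/eqP.
by rewrite /m; ring.
Qed.
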